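(* Let $d\ge 5$ be odd. For the field $$\mathbb{K}_d=\mathbb{C}\left(\mathrm{Sym}^2(\mathbb{C}^d)^{\vee}\otimes\mathbb{C}^3\right)^{\mathrm{SL}_d(\mathbb{C})\times\mathrm{SL}_3(\mathbb{C})\times\mathbb{C}^{\ast}}$$ one has an isomorphism $$\mathbb{K}_d\simeq\mathbb{C}\left(\mathrm{Sym}^3(\mathbb{C}^d)/\mathrm{Sym}^3(F)\right)^{P}.$$
   Context: For a vector space $U$ with a linear action of a group $\Gamma$, $\mathbb{C}(U)^\Gamma$ denotes the field of $\Gamma$-invariant rational functions on $U$. On $\mathrm{Sym}^2(\mathbb{C}^d)^{\vee}\otimes\mathbb{C}^3$ the groups $\mathrm{SL}_d(\mathbb{C})$ and $\mathrm{SL}_3(\mathbb{C})$ act naturally and $\mathbb{C}^{\ast}$ acts by homotheties. Let $e_1,\dots,e_d$ be the standard basis of $\mathbb{C}^d$ and $F:=\langle e_4,\dots,e_d\rangle\subset\mathbb{C}^d$. Let $$P=\left\{\begin{pmatrix} s&0\\ \ast&S\end{pmatrix} : S\in\mathrm{GL}_{d-3}(\mathbb{C}),\ s\in\mathrm{GL}_3(\mathbb{C})\right\}\subset\mathrm{GL}_d(\mathbb{C}),$$ where $\ast$ is an arbitrary $(d-3)\times 3$ block. $P$ preserves $F$, hence acts linearly on the quotient space $\mathrm{Sym}^3(\mathbb{C}^d)/\mathrm{Sym}^3(F)$ via the standard representation of $\mathrm{GL}_d(\mathbb{C})$ on $\mathbb{C}^d$. *)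

(* Defs.v *)
From HB Require Import structures.
From mathcomp Require Import all_boot all_order all_algebra.
From mathcomp Require Import complex mpoly.
From mathcomp Require Import boolp reals.

Set Implicit Arguments.
Unset Strict Implicit.
Unset Printing Implicit Defensive.

Import GRing.Theory.
Local Open Scope ring_scope.

Lemma comp_mpoly_comp (F : comNzRingType) (n m k : nat) (p : {mpoly F[n]})
    (t : n.-tuple {mpoly F[m]}) (s : m.-tuple {mpoly F[k]}) :
  (p \mPo t) \mPo s = p \mPo [tuple tnth t i \mPo s | i < n].
Proof.
rewrite [p \mPo t]comp_mpolyE linear_sum /= [RHS]comp_mpolyE.
apply: eq_bigr => a _; rewrite comp_mpolyZ rmorph_prod; congr (_ *: _).
by apply: eq_bigr => i _; rewrite rmorphXn tnth_mktuple.
Qed.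

Lemma comp_mpolyXtnth (F : comNzRingType) (n k : nat) (i : 'I_n)
    (t : n.-tuple {mpoly F[k]}) : 'X_i \mPo t = tnth t i.
Proof. by rewrite comp_mpolyXU -tnth_nth. Qed.

Section Groups.
Variables (F : fieldType) (n : nat).

Record GL := MkGL { GLval :> 'M[F]_n; _ : GLval \in unitmx }.
HB.instance Definition _ := [isSub for GLval].
HB.instance Definition _ := [Choice of GL by <:].

Definition GL_one : GL := Sub 1%:M (unitmx1 F n).
Definition GL_mul (A B : GL) : GL :=
  Sub (val A *m val B)
    (etrans (unitmx_mul _ _) (introT andP (conj (valP A) (valP B)))).
Definition GL_inv (A : GL) : GL :=
  Sub (invmx (val A)) (etrans (unitmx_inv _) (valP A)).

Fact GL_mulA : associative GL_mul.
Proof. by move=> A B C; apply: val_inj; rewrite /= mulmxA. Qed.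
Fact GL_mul1 : left_id GL_one GL_mul.
Proof. by move=> A; apply: val_inj; rewrite /= mul1mx. Qed.
Fact GL_mulg1 : right_id GL_one GL_mul.
Proof. by move=> A; apply: val_inj; rewrite /= mulmx1. Qed.
Fact GL_mulV : left_inverse GL_one GL_inv GL_mul.
Proof. by move=> A; apply: val_inj; rewrite /= mulVmx ?(valP A). Qed.
Fact GL_mulgV : right_inverse GL_one GL_inv GL_mul.
Proof. by move=> A; apply: val_inj; rewrite /= mulmxV ?(valP A). Qed.

HB.instance Definition _ :=
  isGroup.Build GL GL_mulA GL_mul1 GL_mulg1 GL_mulV GL_mulgV.

Definition SL_pred : pred GL := fun A => \det (val A) == 1.

Fact SL_closed : group_closed SL_pred.
Proof.
split=> [|A B]; rewrite !unfold_in /= ?det1 // => /eqP dA /eqP dB.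
by rewrite /= det_mulmx det_inv dA dB invr1 mulr1.
Qed.

Record SL := MkSL { SLval :> GL; _ : SL_pred SLval }.
HB.instance Definition _ := [isSub for SLval].
HB.instance Definition _ := [Choice of SL by <:].
HB.instance Definition _ :=
  SubChoice_isSubGroup.Build GL SL_pred SL SL_closed.

(* Invertible matrices of block shape [s 0; * S] with s of size 3; s and S are
   then invertible, see parab_block. *)
Definition parab_pred : pred GL := fun A =>
  [forall i : 'I_n, forall j : 'I_n, (i < 3 <= j)%N ==> (val A i j == 0)].

Lemma parab_predP (A : GL) :
  reflect (forall i j : 'I_n, (i < 3)%N -> (3 <= j)%N -> val A i j = 0)
          (parab_pred A).
Proof.
apply: (iffP forallP) => [H i j i3 j3|H i].
  by have /forallP/(_ j)/implyP/(_ _)/eqP -> := H i; rewrite ?i3.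
by apply/forallP => j; apply/implyP => /andP[i3 j3]; rewrite H.
Qed.

Fact parab_closed : group_closed parab_pred.
Proof.
pose D : 'M[F]_n := pid_mx 3.
have DP (M : 'M[F]_n) : (D *m M <= D)%MS <->
    (forall i j : 'I_n, (i < 3)%N -> (3 <= j)%N -> M i j = 0).
  have DE i j : (D *m M) i j = if (i < 3)%N then M i j else 0.
    rewrite mxE (bigD1 i) //= big1 => [|k ki].
      by rewrite mxE eqxx /= addr0; case: ifP => _; rewrite ?mul1r ?mul0r.
    by rewrite mxE eq_sym -val_eqE /= in ki *; rewrite (negPf ki) mul0r.
  split=> [/submxP[X DX] i j i3 j3|H].
    have := DE i j; rewrite i3 DX => <-; rewrite mxE big1 // => k _.
    rewrite mxE; case: eqP => [kj|]; last by rewrite mulr0.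
    by rewrite kj ltnNge j3 mulr0.
  suff -> : D *m M = (D *m M) *m D by apply: submxMl.
  apply/matrixP => i j; rewrite [RHS]mxE (bigD1 j) //= big1 => [|k kj].
    rewrite [D j j]mxE eqxx /= addr0 DE; case: (ltnP j 3) => j3.
      by rewrite mulr1.
    by rewrite mulr0; case: ifP => // i3; rewrite H.
  by rewrite [D k j]mxE -val_eqE /= in kj *; rewrite (negPf kj) mulr0.
split=> [|A B].
  apply/parab_predP => i j i3 j3; rewrite mxE -val_eqE /=.
  by case: eqP => // ij; rewrite ij ltnNge j3 in i3.
move=> /parab_predP/DP DA /parab_predP/DP DB; apply/parab_predP/DP => /=.
have uB := valP B.
have DBV : (D <= D *m val B)%MS.
  have := mxrank_leqif_eq DB; rewrite mxrankMfree ?row_free_unit //.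
  by case=> _; rewrite eqxx => /esym /andP[].
rewrite mulmxA; apply: submx_trans (submxMr _ DA) _.
by rewrite -[X in (_ <= X)%MS](mulmxK uB) submxMr.
Qed.

Record parab := MkParab { parabval :> GL; _ : parab_pred parabval }.
HB.instance Definition _ := [isSub for parabval].
HB.instance Definition _ := [Choice of parab by <:].
HB.instance Definition _ :=
  SubChoice_isSubGroup.Build GL parab_pred parab parab_closed.

End Groups.

Lemma parab_block (F : fieldType) (m : nat) (A : GL F (3 + m)) :
  reflect (exists s B S, [/\ s \in unitmx, S \in unitmx &
                             val A = block_mx s 0 B S])
          (parab_pred A).
Proof.
apply: (iffP (parab_predP A)) => [H|[s [B [S [_ _ ->]]]] i j i3 j3].
  have E : val A = block_mx (ulsubmx (val A)) 0 (dlsubmx (val A))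
                            (drsubmx (val A)).
    rewrite -[LHS]submxK; congr block_mx; apply/matrixP => i j.
    by rewrite !mxE H ?leq_addr //=.
  have := valP A; rewrite E unitmxE det_lblock unitrM -!unitmxE => /andP[us uS].
  by exists (ulsubmx (val A)), (dlsubmx (val A)), (drsubmx (val A)).
have -> : i = lshift m (Ordinal i3) by apply: val_inj.
have jm : (j - 3 < m)%N by rewrite ltn_subLR.
have -> : j = rshift 3 (Ordinal jm) by apply: val_inj; rewrite /= subnKC.
by rewrite block_mxEur mxE.
Qed.

Arguments GL : clear implicits.
Arguments SL : clear implicits.
Arguments parab : clear implicits.

Section MultiplicativeGroup.
Variable F : fieldType.

Record Gm := MkGm { Gmval :> F; _ : Gmval != 0 }.
HB.instance Definition _ := [isSub for Gmval].
HB.instance Definition _ := [Choice of Gm by <:].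

Definition Gm_one : Gm := Sub 1 (oner_neq0 F).
Definition Gm_mul (x y : Gm) : Gm :=
  Sub (val x * val y) (mulf_neq0 (valP x) (valP y)).
Definition Gm_inv (x : Gm) : Gm := Sub (val x)^-1 (invr_neq0 (valP x)).

Fact Gm_mulA : associative Gm_mul.
Proof. by move=> x y z; apply: val_inj; rewrite /= mulrA. Qed.
Fact Gm_mul1 : left_id Gm_one Gm_mul.
Proof. by move=> x; apply: val_inj; rewrite /= mul1r. Qed.
Fact Gm_mulg1 : right_id Gm_one Gm_mul.
Proof. by move=> x; apply: val_inj; rewrite /= mulr1. Qed.
Fact Gm_mulV : left_inverse Gm_one Gm_inv Gm_mul.
Proof. by move=> x; apply: val_inj; rewrite /= mulVf ?(valP x). Qed.
Fact Gm_mulgV : right_inverse Gm_one Gm_inv Gm_mul.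
Proof. by move=> x; apply: val_inj; rewrite /= mulfV ?(valP x). Qed.

HB.instance Definition _ :=
  isGroup.Build Gm Gm_mulA Gm_mul1 Gm_mulg1 Gm_mulV Gm_mulgV.

End MultiplicativeGroup.

Section ProductGroup.
Variables G H : groupType.

Definition prodg : Type := (G * H)%type.
HB.instance Definition _ := Choice.on prodg.

Local Open Scope group_scope.
Definition prodg_one : prodg := (1, 1).
Definition prodg_mul (x y : prodg) : prodg := (x.1 * y.1, x.2 * y.2).
Definition prodg_inv (x : prodg) : prodg := (x.1^-1, x.2^-1).

Fact prodg_mulA : associative prodg_mul.
Proof. by move=> x y z; rewrite /prodg_mul !mulgA. Qed.
Fact prodg_mul1 : left_id prodg_one prodg_mul.
Proof. by case=> x y; rewrite /prodg_mul !mul1g. Qed.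
Fact prodg_mulg1 : right_id prodg_one prodg_mul.
Proof. by case=> x y; rewrite /prodg_mul !mulg1. Qed.
Fact prodg_mulV : left_inverse prodg_one prodg_inv prodg_mul.
Proof. by move=> x; rewrite /prodg_mul !mulVg. Qed.
Fact prodg_mulgV : right_inverse prodg_one prodg_inv prodg_mul.
Proof. by move=> x; rewrite /prodg_mul !mulgV. Qed.

HB.instance Definition _ :=
  isGroup.Build prodg prodg_mulA prodg_mul1 prodg_mulg1 prodg_mulV prodg_mulgV.

End ProductGroup.

Record linrep (G : groupType) (F : fieldType) (U : vectType F) := Linrep {
  linrep_fun :> G -> 'End(U);
  linrep1 : linrep_fun 1%g = \1%VF;
  linrepM : forall g h, linrep_fun (g * h)%g = (linrep_fun g \o linrep_fun h)%VF
}.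

Section RationalFunctions.
Variables (F : fieldType) (U : vectType F).

(* 'X_i is the i-th coordinate function on U in the basis vbasis {:U}. *)
Local Notation polyfun := {mpoly F[\dim {:U}]}.

Definition ratfun_const (c : F) : {fraction polyfun} :=
  FracField.tofrac (c%:MP : polyfun).

Definition evalpoly (p : polyfun) (u : U) : F :=
  p.@[fun i => coord (vbasis {:U}) i u].

(* p |-> p \o f *)
Definition polypull (f : 'End(U)) (p : polyfun) : polyfun :=
  p \mPo [tuple \sum_(j < \dim {:U})
             coord (vbasis {:U}) i (f (vbasis {:U})`_j) *: 'X_j
         | i < \dim {:U}].

Lemma evalpoly_pull f p u : evalpoly (polypull f p) u = evalpoly p (f u).
Proof.
rewrite /evalpoly /polypull comp_mpoly_meval; apply: meval_eq => i.
rewrite tnth_mktuple raddf_sum /= [in RHS](coord_vbasis (memvf u)).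
rewrite !linear_sum; apply: eq_bigr => j _.
by rewrite mevalZ mevalXU !linearZ /= mulrC.
Qed.

Lemma polypull1 p : polypull \1 p = p.
Proof.
rewrite -[RHS]comp_mpoly_id; congr (_ \mPo _); apply: eq_from_tnth => i.
rewrite !tnth_mktuple (bigD1 i) //= big1 => [|j ji]; rewrite id_lfunE.
  by rewrite coord_free ?(basis_free (vbasisP _)) // eqxx scale1r addr0.
by rewrite coord_free ?(basis_free (vbasisP _)) // (negPf ji) scale0r.
Qed.

Lemma polypull_comp f g p : polypull (f \o g) p = polypull g (polypull f p).
Proof.
rewrite /polypull comp_mpoly_comp; congr (_ \mPo _); apply: eq_from_tnth => i.
rewrite !tnth_mktuple linear_sum /=.
under [RHS]eq_bigr => k _ do
  rewrite comp_mpolyZ comp_mpolyXtnth tnth_mktuple scaler_sumr.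
rewrite exchange_big /=; apply: eq_bigr => j _.
rewrite comp_lfunE [g _ in LHS](coord_vbasis (memvf _)) !linear_sum /=.
rewrite scaler_suml; apply: eq_bigr => k _.
by rewrite scalerA !linearZ /= mulrC.
Qed.

End RationalFunctions.

Section Invariants.
Variables (F : fieldType) (U : vectType F) (G : groupType) (rho : linrep G U).
Local Notation polyfun := {mpoly F[\dim {:U}]}.
Local Notation ratfun := {fraction polyfun}.
Local Notation "p %:F" := (@FracField.tofrac polyfun p).

(* (g . p)(u) = p (rho (g^-1) u), first on polynomial functions, then on
   numerators and denominators *)
Definition polyact (g : G) : polyfun -> polyfun := polypull (rho g^-1%g).

Definition ratact (g : G) (x : ratfun) : ratfun :=
  (polyact g \n_(repr x))%:F / (polyact g \d_(repr x))%:F.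

HB.instance Definition _ g := GRing.RMorphism.copy (polyact g)
  (comp_mpoly [tuple \sum_(j < \dim {:U})
     coord (vbasis {:U}) i (rho g^-1%g (vbasis {:U})`_j) *: 'X_j
     | i < \dim {:U}]).

Lemma polyactK g : cancel (polyact g) (polyact g^-1%g).
Proof.
move=> p; rewrite /polyact -polypull_comp -linrepM mulgV.
by rewrite linrep1 polypull1.
Qed.

Lemma polyact_eq0 g p : (polyact g p == 0) = (p == 0).
Proof. by rewrite -[RHS](inj_eq (can_inj (polyactK g))) rmorph0. Qed.

Lemma ratfun_numden (x : ratfun) : x = (\n_(repr x))%:F / (\d_(repr x))%:F.
Proof.
have d0 := denom_ratioP (repr x).
have dx : (\d_(repr x))%:F != 0 by rewrite tofrac_eq0.
apply: (mulIf dx); rewrite mulfVK // -{1}[x]reprK; unlock FracField.tofrac.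
rewrite -[LHS]FracField.pi_mul; apply/eqmodP.
by rewrite /= FracField.equivfE /FracField.mulf !numden_Ratio ?oner_eq0
  ?mulr1 //= mulrC.
Qed.

Lemma ratactE g p q :
  q != 0 -> ratact g (p%:F / q%:F) = (polyact g p)%:F / (polyact g q)%:F.
Proof.
move=> q0; rewrite /ratact; set r := repr _.
have := ratfun_numden (p%:F / q%:F); rewrite -/r => E.
have d0 := denom_ratioP r.
move/eqP: E; rewrite eqr_div ?tofrac_eq0 // -!tofracM tofrac_eq => /eqP E.
apply/eqP; rewrite eqr_div ?tofrac_eq0 ?polyact_eq0 // -!tofracM tofrac_eq.
by rewrite -!rmorphM E.
Qed.

Fact ratact_zmod_morphism g : zmod_morphism (ratact g).
Proof.
move=> x y; rewrite [x]ratfun_numden [y]ratfun_numden.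
set a := \n__; set b := \d__; set c := \n__; set d := \d__.
have b0 : b != 0 by apply: denom_ratioP.
have d0 : d != 0 by apply: denom_ratioP.
rewrite -mulNr addf_div ?tofrac_eq0 // mulNr -!tofracM -tofracB.
rewrite !ratactE ?mulf_neq0 // -[in RHS]mulNr.
rewrite [RHS]addf_div ?tofrac_eq0 ?polyact_eq0 //.
by rewrite rmorphB !rmorphM mulNr /= tofracB !tofracM.
Qed.

Fact ratact_monoid_morphism g : monoid_morphism (ratact g).
Proof.
split=> [|x y].
  have -> : 1 = 1%:F / 1%:F by rewrite tofrac1 divr1.
  by rewrite ratactE ?oner_eq0 // rmorph1.
rewrite [x]ratfun_numden [y]ratfun_numden.
set a := \n__; set b := \d__; set c := \n__; set d := \d__.
have b0 : b != 0 by apply: denom_ratioP.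
have d0 : d != 0 by apply: denom_ratioP.
rewrite mulf_div -!tofracM !ratactE ?mulf_neq0 // mulf_div.
by rewrite !rmorphM.
Qed.

HB.instance Definition _ g := GRing.isZmodMorphism.Build ratfun ratfun
  (ratact g) (ratact_zmod_morphism g).
HB.instance Definition _ g := GRing.isMonoidMorphism.Build ratfun ratfun
  (ratact g) (ratact_monoid_morphism g).

Definition inv_pred : pred ratfun := fun x => `[< forall g, ratact g x = x >].

Fact inv_divring_closed : divring_closed inv_pred.
Proof.
split=> [|x y|x y].
- by apply/asboolP => g; rewrite rmorph1.
- by move=> /asboolP Hx /asboolP Hy; apply/asboolP => g; rewrite rmorphB /= Hx Hy.
by move=> /asboolP Hx /asboolP Hy; apply/asboolP => g; rewrite fmorph_div /= Hx Hy.
Qed.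

(* the field F(U)^G *)
Record invfield := MkInvfield { invfield_val :> ratfun;
                                _ : inv_pred invfield_val }.
HB.instance Definition _ := [isSub for invfield_val].
HB.instance Definition _ := [Choice of invfield by <:].
HB.instance Definition _ := GRing.SubChoice_isSubComUnitRing.Build
  ratfun inv_pred invfield inv_divring_closed.
HB.instance Definition _ := [SubComUnitRing_isSubIntegralDomain of invfield by <:].

Fact invfield_unit :
  {mono (val : invfield -> ratfun) : u / u \in GRing.unit}.
Proof.
move=> u; apply/idP/idP => [uU|]; last exact: rmorph_unit.
have uV : inv_pred (val u)^-1.
  by apply/asboolP => g; rewrite fmorphV /= (asboolW (valP u)).
apply/unitrPr; exists (MkInvfield uV); apply: val_inj.
by rewrite rmorphM rmorph1 /= divrr.
Qed.
HB.instance Definition _ := GRing.SubIntegralDomain_isSubField.Build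
  ratfun inv_pred invfield invfield_unit.

Lemma polyactC g (c : F) : polyact g c%:MP = c%:MP.
Proof. by rewrite /polyact /polypull comp_mpolyC. Qed.

Fact inv_const c : inv_pred (ratfun_const U c).
Proof.
apply/asboolP => g; rewrite /ratfun_const.
have -> : (c%:MP)%:F = (c%:MP)%:F / 1%:F by rewrite tofrac1 divr1.
by rewrite ratactE ?oner_eq0 // polyactC rmorph1.
Qed.

(* the embedding of the scalars, F -> F(U)^G *)
Definition inv_scalar (c : F) : invfield := MkInvfield (inv_const c).

End Invariants.

Section QuotientSpace.
Variables (F : fieldType) (V : vectType F) (W : {vspace V}).

Definition quotv := Quotient.quot (pred_of_vspace W).
HB.instance Definition _ := Choice.on quotv.
HB.instance Definition _ := GRing.Zmodule.on quotv.

Definition quotv_pi (v : V) : quotv := (\pi_quotv v)%qT.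
Definition quotv_repr (x : quotv) : V := repr x.

Lemma quotv_reprK : cancel quotv_repr quotv_pi.
Proof. exact: reprK. Qed.

Lemma quotv_piP u v : (quotv_pi u = quotv_pi v) <-> (u - v \in W).
Proof. by rewrite [u - v \in W]Quotient.idealrBE; split=> /eqP. Qed.

Fact quotv_pi_zmod_morphism : zmod_morphism quotv_pi.
Proof.
move=> u v; exact: (pi_is_zmod_morphism
  (Quotient.quot (pred_of_vspace W))).
Qed.
HB.instance Definition _ :=
  GRing.isZmodMorphism.Build V quotv quotv_pi quotv_pi_zmod_morphism.

Lemma quotv_reprP v : quotv_repr (quotv_pi v) - v \in W.
Proof. by apply/quotv_piP; rewrite quotv_reprK. Qed.

Definition quotv_scale (a : F) (x : quotv) : quotv :=
  quotv_pi (a *: quotv_repr x).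

Fact quotv_scaleE a v : quotv_scale a (quotv_pi v) = quotv_pi (a *: v).
Proof. by apply/quotv_piP; rewrite -scalerBr memvZ ?quotv_reprP. Qed.

Fact quotv_scaleA a b x :
  quotv_scale a (quotv_scale b x) = quotv_scale (a * b) x.
Proof. by rewrite -[x]quotv_reprK !quotv_scaleE scalerA. Qed.
Fact quotv_scale1 : left_id 1 quotv_scale.
Proof. by move=> x; rewrite -[x]quotv_reprK quotv_scaleE scale1r. Qed.
Fact quotv_scaleDr : right_distributive quotv_scale +%R.
Proof.
move=> a x y; rewrite -[x]quotv_reprK -[y]quotv_reprK.
by rewrite -raddfD !quotv_scaleE scalerDr raddfD.
Qed.
Fact quotv_scaleDl x : {morph quotv_scale^~ x : a b / a + b}.
Proof.
move=> a b; rewrite -[x]quotv_reprK !quotv_scaleE.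
by rewrite scalerDl raddfD.
Qed.
HB.instance Definition _ := GRing.Zmodule_isLmodule.Build F quotv
  quotv_scaleA quotv_scale1 quotv_scaleDr quotv_scaleDl.

Fact quotv_pi_scalable : scalable quotv_pi.
Proof. by move=> a v; rewrite -quotv_scaleE. Qed.
HB.instance Definition _ :=
  GRing.isScalable.Build F V quotv *:%R quotv_pi quotv_pi_scalable.

Let p : 'End(V) := (\1 - projv W)%VF.
Let C : {vspace V} := limg p.

Let pE v : p v = v - projv W v.
Proof. by rewrite add_lfunE opp_lfunE id_lfunE. Qed.

Let pW v : v \in W -> p v = 0.
Proof. by move=> vW; rewrite pE projv_id // subrr. Qed.

Let p_repr v : p (quotv_repr (quotv_pi v)) = p v.
Proof. by apply/eqP; rewrite -subr_eq0 -linearB /= pW ?quotv_reprP. Qed.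

Let p_C v : v \in C -> p v = v.
Proof.
case/memv_imgP=> u _ ->; rewrite [p u in LHS]pE linearB /=.
by rewrite (pW (memv_proj W u)) subr0.
Qed.

Fact quotv_vect_iso : Vector.axiom (\dim C) quotv.
Proof.
exists (fun x => \row_i coord (vbasis C) i (p (quotv_repr x))).
  move=> a x y; apply/rowP => i; rewrite !mxE.
  rewrite -{1}[x]quotv_reprK -{1}[y]quotv_reprK -linearP p_repr.
  by rewrite !linearP.
exists (fun r : 'rV_(\dim C) => quotv_pi (\sum_i r 0 i *: (vbasis C)`_i)).
  move=> x; rewrite -[RHS]quotv_reprK; apply/quotv_piP.
  under eq_bigr => i _ do rewrite mxE.
  rewrite -(coord_vbasis (memv_img p (memvf _))) pE addrAC subrr add0r.
  by rewrite rpredN memv_proj.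
move=> r; apply/rowP => i; rewrite mxE p_repr p_C.
  by rewrite coord_sum_free ?(basis_free (vbasisP _)).
by apply: rpred_sum => j _; rewrite rpredZ ?vbasis_mem ?memt_nth.
Qed.
HB.instance Definition _ := Lmodule_hasFinDim.Build F quotv quotv_vect_iso.

End QuotientSpace.

Section QuotientRepresentation.
Variables (F : fieldType) (V : vectType F) (G : groupType) (rho : linrep G V).
Variable W : {vspace V}.
Hypothesis stabW : forall g, (rho g @: W <= W)%VS.

Definition quotrep_fun (g : G) (x : quotv W) : quotv W :=
  quotv_pi W (rho g (quotv_repr x)).

Lemma quotrep_funE g v : quotrep_fun g (quotv_pi W v) = quotv_pi W (rho g v).
Proof.
apply/quotv_piP; rewrite -linearB; apply: (subvP (stabW g)).
by rewrite memv_img ?quotv_reprP.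
Qed.

Fact quotrep_fun_linear g : linear (quotrep_fun g).
Proof.
move=> a x y; rewrite -[x]quotv_reprK -[y]quotv_reprK -linearP.
by rewrite !quotrep_funE !linearP.
Qed.
HB.instance Definition _ g := GRing.isLinear.Build F (quotv W) (quotv W) *:%R
  (quotrep_fun g) (quotrep_fun_linear g).

Fact quotrep1 : linfun (quotrep_fun 1%g) = \1%VF.
Proof.
apply/lfunP => x; rewrite lfunE /= -[x]quotv_reprK quotrep_funE linrep1.
by rewrite !id_lfunE.
Qed.

Fact quotrepM g h : linfun (quotrep_fun (g * h)%g)
  = (linfun (quotrep_fun g) \o linfun (quotrep_fun h))%VF.
Proof.
apply/lfunP => x; rewrite comp_lfunE !lfunE /= -[x]quotv_reprK.
by rewrite !quotrep_funE linrepM comp_lfunE.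
Qed.

Definition quotrep : linrep G (quotv W) := Linrep quotrep1 quotrepM.

End QuotientRepresentation.

Section SymmetricPowers.
Variable F : fieldType.

(* Sym^k(F^n): homogeneous polynomials of degree k in the basis vectors
   'X_0, ..., 'X_(n-1) of F^n *)
Definition symv (k n : nat) := dhomog n F k.
HB.instance Definition _ k n := GRing.Lmodule.on (symv k n).

Definition symv_dim (k n : nat) : nat :=
  if n is m.+1 then 'C(k + m, k) else k == 0%N.

Fact symv_vect_iso k n : Vector.axiom (symv_dim k n) (symv k n).
Proof.
case: n => [|n]; last exact: dhomog_vecaxiom.
have m0 (m : 'X_{1..0}) : m = 0%MM by apply/mnmP; case.
case: k => [|k]; last first.
  exists (fun=> 0) => [a p q|]; first by rewrite scaler0 addr0.
  exists (fun=> 0) => [p|r]; last by apply/rowP; case.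
  apply/val_inj/mpolyP => m; rewrite mcoeff0; symmetry.
  apply: (dhomog_nemf_coeff (mf := mdeg)); first exact: (valP p).
  by rewrite (m0 m) mf0.
exists (fun p : symv 0 0 => const_mx (val p)@_0%MM).
  by move=> a p q; apply/rowP => i; rewrite !mxE /= mcoeffD mcoeffZ.
have hom (c : F) : c%:MP_[0] \is 0.-homog.
  by rewrite -[c%:MP]mulr1 mul_mpolyC dhomogZ ?dhomog1.
exists (fun r : 'rV_1 => DHomog (hom (r 0 0))) => [p|r].
  apply/val_inj/mpolyP => m; rewrite (m0 m) /= mxE.
  by rewrite mcoeffC eqxx mulr1.
by apply/rowP => i; rewrite mxE /= mcoeffC eqxx mulr1 ord1.
Qed.
HB.instance Definition _ k n :=
  Lmodule_hasFinDim.Build F (symv k n) (symv_vect_iso k n).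

Lemma subst_homog (k n m : nat) (t : n.-tuple {mpoly F[m]}) (p : {mpoly F[n]}) :
  (forall i, tnth t i \is 1.-homog) -> p \is k.-homog -> p \mPo t \is k.-homog.
Proof.
move=> ht /dhomogP hp; rewrite comp_mpolyE big_seq rpred_sum // => a ha.
have <- : mdeg a = k by apply: hp.
apply: dhomogZ; rewrite mdegE.
apply: (big_ind2 (fun (q : {mpoly F[m]}) (e : nat) => q \is e.-homog)).
- exact: dhomog1.
- by move=> p1 e1 p2 e2; apply: dhomogM.
by move=> i _; rewrite -[X in X.-homog]mul1n; apply: dhomogMn.
Qed.

(* the image of the j-th basis vector under A, as an element of Sym^1 *)
Definition subst_mx (m n : nat) (A : 'M[F]_(m, n)) : n.-tuple {mpoly F[m]} :=
  [tuple \sum_i A i j *: 'X_i | j < n].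

Fact subst_mx_homog m n k (A : 'M[F]_(m, n)) (p : symv k n) :
  val p \mPo subst_mx A \is k.-homog.
Proof.
apply: subst_homog => [j|]; last exact: dhomog_is_dhomog.
rewrite tnth_mktuple rpred_sum // => i _; apply: dhomogZ.
by rewrite dhomogX; apply/eqP/mdeg1.
Qed.

Definition symmap_fun m n k (A : 'M[F]_(m, n)) (p : symv k n) : symv k m :=
  DHomog (subst_mx_homog A p).

Fact symmap_linear m n k (A : 'M[F]_(m, n)) : linear (@symmap_fun m n k A).
Proof. by move=> a p q; apply: val_inj; rewrite /= linearP. Qed.
HB.instance Definition _ m n k (A : 'M[F]_(m, n)) :=
  GRing.isLinear.Build F (symv k n) (symv k m) *:%R (@symmap_fun m n k A)
    (@symmap_linear m n k A).

(* Sym^k(A) : Sym^k(F^n) -> Sym^k(F^m) *)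
Definition symmap k m n (A : 'M[F]_(m, n)) : 'Hom(symv k n, symv k m) :=
  linfun (symmap_fun A).

Lemma symmapE k m n (A : 'M[F]_(m, n)) (p : symv k n) :
  val (symmap k A p) = val p \mPo subst_mx A.
Proof. by rewrite lfunE. Qed.

Lemma symmap1 k n : symmap k (1%:M : 'M[F]_n) = \1%VF.
Proof.
apply/lfunP => p; apply: val_inj; rewrite symmapE id_lfunE.
rewrite -[RHS]comp_mpoly_id; congr (_ \mPo _); apply: eq_from_tnth => j.
rewrite !tnth_mktuple (bigD1 j) //= big1 => [|i ij].
  by rewrite mxE eqxx scale1r addr0.
by rewrite mxE (negPf ij) scale0r.
Qed.

Lemma symmapM k l m n (A : 'M[F]_(l, m)) (B : 'M[F]_(m, n)) :
  symmap k (A *m B) = (symmap k A \o symmap k B)%VF.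
Proof.
apply/lfunP => p; apply: val_inj; rewrite comp_lfunE !symmapE comp_mpoly_comp.
congr (_ \mPo _); apply: eq_from_tnth => j; rewrite !tnth_mktuple linear_sum /=.
under [RHS]eq_bigr => i _ do
  rewrite comp_mpolyZ comp_mpolyXtnth tnth_mktuple scaler_sumr.
rewrite exchange_big; apply: eq_bigr => i _ /=.
rewrite mxE scaler_suml; apply: eq_bigr => a _.
by rewrite scalerA mulrC.
Qed.

End SymmetricPowers.
Arguments symv : clear implicits.

Section Nets.
Variables (F : fieldType) (d : nat).

(* Sym^2(F^d)^* (x) F^3, as linear maps Sym^2(F^d) -> F^3 *)
Local Notation nets := 'Hom(symv F 2 d, 'cV[F]_3).
Local Notation netgroup := (prodg (prodg (SL F d) (SL F 3)) (Gm F)).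

(* c . h o phi o Sym^2(g)^-1; on a pure tensor l (x) v this is
   c . ((g . l) (x) (h v)) *)
Definition netact (x : netgroup) (phi : nets) : nets :=
  let: (g, h, c) := x in
  (c : F) *: (linfun (mulmx h) \o phi \o symmap 2 (g^-1%g : SL F d))%VF.

Lemma netactE g h c phi u :
  netact (g, h, c) phi u = (c : F) *: (h *m phi (symmap 2 (g^-1%g : SL F d) u)).
Proof. by rewrite /netact scale_lfunE !comp_lfunE lfunE. Qed.

Definition pure_tensor (l : 'Hom(symv F 2 d, F^o)) (v : 'cV[F]_3) : nets :=
  linfun (fun u => (l u : F) *: v).

Lemma pure_tensorE l v u : pure_tensor l v u = (l u : F) *: v.
Proof.
have lin : linear (fun u => (l u : F) *: v).
  by move=> a x y; rewrite linearP scalerDl -scalerA.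
pose T := GRing.isLinear.Build _ _ _ _ _ lin.
pose f : {linear symv F 2 d -> 'cV[F]_3} := HB.pack (fun u => (l u : F) *: v) T.
exact: (lfunE f).
Qed.

Lemma netact_tensor (g : SL F d) (h : SL F 3) (c : Gm F) l v :
  netact (g, h, c) (pure_tensor l v) =
  (c : F) *: pure_tensor (l \o symmap 2 (g^-1%g : SL F d)) (h *m v).
Proof.
apply/lfunP => u; rewrite netactE scale_lfunE !pure_tensorE comp_lfunE.
by rewrite -scalemxAr.
Qed.

Fact netact_linear x : linear (netact x).
Proof.
case: x => [[g h] c] a phi psi; apply/lfunP => u.
rewrite [RHS]add_lfunE [X in _ = X + _]scale_lfunE !netactE.
rewrite add_lfunE scale_lfunE.
by rewrite mulmxDr -scalemxAr scalerDr !scalerA mulrC.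
Qed.
HB.instance Definition _ x :=
  GRing.isLinear.Build F nets nets *:%R (netact x) (netact_linear x).

Lemma lin_netactE x phi : linfun (netact x) phi = netact x phi.
Proof. exact: lfunE. Qed.

Fact netrep1 : linfun (netact 1%g) = \1%VF.
Proof.
apply/lfunP => phi; apply/lfunP => u; rewrite id_lfunE lin_netactE.
rewrite [LHS](netactE 1%g 1%g 1%g).
by rewrite scale1r mul1mx invg1 symmap1 id_lfunE.
Qed.

Fact netrepM x y :
  linfun (netact (x * y)%g) = (linfun (netact x) \o linfun (netact y))%VF.
Proof.
case: x y => [[g h] c] [[g' h'] c'].
apply/lfunP => phi; apply/lfunP => u; rewrite comp_lfunE !lin_netactE.
rewrite [LHS](netactE (g * g')%g (h * h')%g (c * c')%g).
rewrite !netactE invgM symmapM comp_lfunE.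
by rewrite -scalemxAr scalerA mulmxA.
Qed.

Definition netrep : linrep netgroup nets := Linrep netrep1 netrepM.

End Nets.

Section ParabolicQuotient.
Variables (F : fieldType) (d : nat).

(* Column j is the basis vector e_(j + 3), indices starting at 0: the inclusion
   of the span of all basis vectors but the first three. *)
Definition incl_mx : 'M[F]_(d, d - 3) := \matrix_(i, j) (i == (j + 3)%N :> nat)%:R.

(* Sym^k of this span, inside Sym^k(F^d) *)
Definition symF (k : nat) : {vspace symv F k d} := limg (symmap k incl_mx).

Lemma parab_incl (A : parab F d) :
  (A : 'M_d) *m incl_mx = incl_mx *m (incl_mx^T *m A *m incl_mx).
Proof.
have inclE m (M : 'M_(m, d)) i (j : 'I_(d - 3)) (lt_j : (j + 3 < d)%N) :
    (M *m incl_mx) i j = M i (Ordinal lt_j).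
  rewrite mxE (bigD1 (Ordinal lt_j)) //= big1 ?mxE ?eqxx ?mulr1 ?addr0 // => k.
  by rewrite -val_eqE /= mxE => /negPf ->; rewrite mulr0.
have lt3 (j : 'I_(d - 3)) : (j + 3 < d)%N by rewrite addnC -ltn_subRL.
have inclTE (M : 'M_d) (k j : 'I_(d - 3)) :
    (incl_mx^T *m M *m incl_mx) k j = M (Ordinal (lt3 k)) (Ordinal (lt3 j)).
  by rewrite inclE -[_ *m M]trmxK trmx_mul trmxK mxE inclE mxE.
apply/matrixP => i j; rewrite (inclE _ _ _ _ (lt3 j)) mxE.
have [i3|i3] := ltnP i 3.
  have /parab_predP -> //= := valP A; last by rewrite leq_addl.
  rewrite big1 // => k _; rewrite mxE.
  case: eqP => [E|_]; last by rewrite mul0r.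
  by rewrite E ltnNge leq_addl in i3.
have lt_i : (i - 3 < d - 3)%N by rewrite ltn_sub2r // (leq_ltn_trans i3).
rewrite (bigD1 (Ordinal lt_i)) //= big1 => [|k].
  rewrite mxE /= subnK // eqxx mul1r addr0 inclTE; congr (GLval _ _ _).
  by apply: val_inj; rewrite /= subnK.
rewrite -val_eqE /= mxE => ki; case: eqP => [E|_]; last by rewrite mul0r.
by rewrite E addnK eqxx in ki.
Qed.

Lemma parab_stab k (A : parab F d) : (symmap k A @: symF k <= symF k)%VS.
Proof.
rewrite /symF -limg_comp -symmapM parab_incl symmapM limg_comp.
by rewrite limgS ?subvf.
Qed.

Fact parabrep1 k : symmap k (1%g : parab F d) = \1%VF.
Proof. exact: symmap1. Qed.
Fact parabrepM k (A B : parab F d) :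
  symmap k (A * B)%g = (symmap k A \o symmap k B)%VF.
Proof. exact: symmapM. Qed.
Definition parabrep k : linrep (parab F d) (symv F k d) :=
  Linrep (parabrep1 k) (parabrepM k).

End ParabolicQuotient.

(* F(Sym^2(F^d)^* (x) F^3)^(SL_d x SL_3 x Gm) *)
Definition netfield (F : fieldType) (d : nat) : fieldType :=
  invfield (netrep F d).

(* F(Sym^3(F^d) / Sym^3(<e_4, ..., e_d>))^P, with e_1, ..., e_d = 'X_0, ... *)
Definition parabquotrep (F : fieldType) (d : nat) :
    linrep (parab F d) (quotv (symF F d 3)) :=
  quotrep (rho := parabrep F d 3) (parab_stab 3).

Definition parabfield (F : fieldType) (d : nat) : fieldType :=
  invfield (parabquotrep F d).

(* Main.v *)
Require Import Defs.
From HB Require Import structures.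
From mathcomp Require Import all_boot all_order all_algebra.
From mathcomp Require Import complex mpoly.
From mathcomp Require Import boolp reals.
From mathcomp Require Import ring zify.

(* A net of quadrics on a d-dimensional space W is a triple of symmetric matrices
   Q_0, Q_1, Q_2. The triples of vectors (v_0, v_1, v_2) with Q_i v_j = Q_j v_i
   form the kernel of a skew-symmetric matrix of size 3d, which for d odd is
   generically a line. Moving a generator of this line to (e_1, e_2, e_3) by
   GL_d brings the net into the linear slice Q_i e_j = Q_j e_i, and this slice is
   Sym^3(C^d) / Sym^3(F): a cubic f corresponds to the quadrics
   (d_1 f, d_2 f, d_3 f). Two points of the slice with one-dimensional kernels are
   in the same orbit of GL_d x GL_3 if and only if they are in the same orbit of
   P, because the kernel line, spanned by (e_1, e_2, e_3), has to be preserved; the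
   remaining scalar is a cube, hence comes from a homothety in P. So restriction
   to the slice and pullback along the rational retraction onto it are mutually
   inverse. All identities between rational functions are checked at generic
   points. *)

Set Implicit Arguments.
Unset Strict Implicit.
Unset Printing Implicit Defensive.

Import Order.TTheory GRing.Theory Num.Theory.
Local Open Scope ring_scope.

(** * Polynomial functions *)


(** In characteristic zero the integers [0, ..., size p - 1] are distinct, and they would be too
    many roots. *)
Lemma poly_nonroot (F : numDomainType) (p : {poly F}) :
  p != 0 -> exists a, p.[a] != 0.
Proof.
move=> p0; apply: contrapT => H.
have /(max_poly_roots p0) : all (root p) [seq i%:R | i <- iota 0 (size p)].
  apply/allP => a _; apply/negP => /negP pa; apply: H; exists a.
  by rewrite rootE in pa.
rewrite map_inj_uniq ?iota_uniq ?size_map ?size_iota ?ltnn => [/(_ isT)//|].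
exact: mulrIn (oner_neq0 _).
Qed.

(** Every coefficient of [p] occurs in [muni p], its expansion in the last variable; hence a nonzero
    [p] has a nonzero coefficient there. *)
Lemma muni_coef (F : nzRingType) n (p : {mpoly F[n.+1]}) (m : 'X_{1..n.+1}) :
  ((muni p)`_(m ord_max))@_[multinom m (widen_ord (leqnSn n) i) | i < n] = p@_m.
Proof.
rewrite muniE coef_sum (raddf_sum (mcoeff _)).
transitivity (\sum_(m' <- msupp p) p@_m' * (m' == m)%:R).
  apply: eq_bigr => m' _; rewrite coefZ coefXn /=.
  have [mE|mN] := eqVneq (m ord_max) (m' ord_max); last first.
    rewrite mulr0n mulr0 mcoeff0; case: eqP => [E|]; last by rewrite mulr0.
    by rewrite E eqxx in mN.
  rewrite mulr1n mulr1 mcoeffZ mcoeffX; congr (_ * (nat_of_bool _)%:R).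
  apply/eqP/eqP => [/mnmP E|->//]; apply/mnmP => i.
  case: (unliftP ord_max i) => [j ->|->//].
  have := E j; rewrite !mnmE.
  by have -> : widen_ord (leqnSn n) j = lift ord_max j by
    apply: val_inj; rewrite /= /bump leqNgt ltn_ord.
rewrite [in RHS](mpolyE p) (raddf_sum (mcoeff _)) /=; apply: eq_bigr => m' _.
by rewrite mcoeffZ mcoeffX.
Qed.

Lemma muni_meval (F : comNzRingType) n (p : {mpoly F[n.+1]}) (v : 'I_n.+1 -> F) :
  p.@[v] =
  (map_poly (meval (fun i => v (widen_ord (leqnSn n) i))) (muni p)).[v ord_max].
Proof.
rewrite muniE mevalE rmorph_sum /= horner_sum; apply: eq_bigr => m _.
rewrite map_polyZ map_polyXn hornerZ hornerXn /= mevalZ mevalX -mulrA.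
by rewrite big_ord_recr; congr (_ * (_ * _)); apply: eq_bigr => i _; rewrite mnmE.
Qed.

(** Induction on the number of variables: first a point where some coefficient in the last variable
    does not vanish, then a value of that variable. *)
Lemma mpoly_nonroot (F : numDomainType) n (p : {mpoly F[n]}) :
  p != 0 -> exists v, p.@[v] != 0.
Proof.
elim: n p => [|n IHn] p p0.
  have m0 (m : 'X_{1..0}) : m = 0%MM by apply/mnmP; case.
  have pE : p = (p@_0%MM)%:MP.
    by apply/mpolyP => m; rewrite (m0 m) mcoeffC eqxx mulr1.
  exists (fun=> 0); apply: contraNneq p0.
  by rewrite {1}pE mevalC => E; rewrite pE E mpolyC0.
have [m pm] : exists m, p@_m != 0.
  apply: contrapT => H; case/eqP: p0; apply/mpolyP => m; rewrite mcoeff0.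
  by apply/eqP/negP => /negP pm; apply: H; exists m.
have c0 : (muni p)`_(m ord_max) != 0.
  by apply: contraNneq pm => E; rewrite -muni_coef E mcoeff0.
have [v cv] := IHn _ c0.
have q0 : map_poly (meval v) (muni p) != 0.
  apply: contraNneq cv => E.
  by rewrite -[X in X == _](coef_map (meval v)) E coef0.
have [a pa] := poly_nonroot q0.
pose w i := if unlift ord_max i is Some j then v j else a.
exists w; rewrite muni_meval {2}/w unlift_none.
congr (_.[_] != 0): pa; apply/polyP => k; rewrite !coef_map /=.
apply: meval_eq => i; rewrite /w.
have -> : widen_ord (leqnSn n) i = lift ord_max i.
  by apply: val_inj; rewrite /= /bump leqNgt ltn_ord.
by rewrite liftK.
Qed.

Section PolynomialFunctions.
Variable F : numFieldType.
Implicit Types U V W : vectType F.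

Lemma evalpolyM U (p q : {mpoly F[\dim {:U}]}) (u : U) :
  evalpoly (p * q) u = evalpoly p u * evalpoly q u.
Proof. exact: mevalM. Qed.

Lemma evalpolyB U (p q : {mpoly F[\dim {:U}]}) (u : U) :
  evalpoly (p - q) u = evalpoly p u - evalpoly q u.
Proof. exact: mevalB. Qed.

Lemma evalpolyC U c (u : U) : evalpoly c%:MP u = c.
Proof. exact: mevalC. Qed.

Lemma evalpoly_nonroot U (p : {mpoly F[\dim {:U}]}) :
  p != 0 -> exists u : U, evalpoly p u != 0.
Proof.
case/mpoly_nonroot => v pv.
exists (\sum_i v i *: (vbasis {:U})`_i); congr (_ != 0): pv.
apply: meval_eq => i.
by rewrite coord_sum_free // (basis_free (vbasisP _)).
Qed.

Lemma evalpoly_inj U (p q : {mpoly F[\dim {:U}]}) :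
  (forall u : U, evalpoly p u = evalpoly q u) -> p = q.
Proof.
move=> E; apply/eqP; rewrite -subr_eq0; apply/negP => /negP.
by case/evalpoly_nonroot => u; rewrite evalpolyB E subrr eqxx.
Qed.

(** Polynomiality is a property of functions on the space itself, so that identities can be checked
    on values instead of on [mpoly] terms. *)
Definition polyfun U (f : U -> F) :=
  exists p : {mpoly F[\dim {:U}]}, forall u, evalpoly p u = f u.

Definition polymap U V (f : U -> V) :=
  forall i, polyfun (fun u => coord (vbasis {:V}) i (f u)).

(** The property holds on a nonempty principal Zariski-open set. *)
Definition generically U (P : U -> Prop) :=
  exists2 D : {mpoly F[\dim {:U}]}, D != 0 & forall u, evalpoly D u != 0 -> P u.

Lemma polyfun_ext U (f g : U -> F) : f =1 g -> polyfun f -> polyfun g.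
Proof. by move=> E [p pE]; exists p => u; rewrite pE E. Qed.

Lemma polyfunC U c : polyfun (fun _ : U => c).
Proof. by exists c%:MP => u; rewrite evalpolyC. Qed.

Lemma polyfunD U (f g : U -> F) :
  polyfun f -> polyfun g -> polyfun (fun u => f u + g u).
Proof.
by move=> [p pE] [q qE]; exists (p + q) => u; rewrite -pE -qE; apply: mevalD.
Qed.

Lemma polyfunM U (f g : U -> F) :
  polyfun f -> polyfun g -> polyfun (fun u => f u * g u).
Proof.
by move=> [p pE] [q qE]; exists (p * q) => u; rewrite -pE -qE evalpolyM.
Qed.

Lemma polyfunN U (f : U -> F) : polyfun f -> polyfun (fun u => - f u).
Proof. by move=> [p pE]; exists (- p) => u; rewrite -pE; apply: mevalN. Qed.

Lemma polyfunB U (f g : U -> F) :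
  polyfun f -> polyfun g -> polyfun (fun u => f u - g u).
Proof. by move=> pf pg; apply/polyfunD/polyfunN. Qed.

Lemma polyfun_sum U (I : Type) (r : seq I) (P : pred I) (f : I -> U -> F) :
  (forall i, polyfun (f i)) -> polyfun (fun u => \sum_(i <- r | P i) f i u).
Proof.
move=> pf; elim: r => [|i r IHr].
  by apply: polyfun_ext (polyfunC U 0) => u; rewrite big_nil.
case Pi: (P i); last by apply: polyfun_ext IHr => u; rewrite big_cons Pi.
by apply: polyfun_ext (polyfunD (pf i) IHr) => u; rewrite big_cons Pi.
Qed.

Lemma polyfun_prod U (I : Type) (r : seq I) (P : pred I) (f : I -> U -> F) :
  (forall i, polyfun (f i)) -> polyfun (fun u => \prod_(i <- r | P i) f i u).
Proof.
move=> pf; elim: r => [|i r IHr].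
  by apply: polyfun_ext (polyfunC U 1) => u; rewrite big_nil.
case Pi: (P i); last by apply: polyfun_ext IHr => u; rewrite big_cons Pi.
by apply: polyfun_ext (polyfunM (pf i) IHr) => u; rewrite big_cons Pi.
Qed.

Lemma polyfun_linear U (f : U -> F) :
  (forall a u v, f (a *: u + v) = a * f u + f v) -> polyfun f.
Proof.
move=> lf.
have f0 : f 0 = 0.
  by have := lf (-1) 0 0; rewrite scaler0 addr0 mulN1r addNr.
have fE u : f u = \sum_i coord (vbasis {:U}) i u * f (vbasis {:U})`_i.
  rewrite {1}(coord_vbasis (memvf u)).
  apply: (big_rec2 (fun x y => f x = y)) => [//|i x y _ <-]; exact: lf.
apply: polyfun_ext (fun u => esym (fE u)) _.
apply: polyfun_sum => i; apply: polyfunM (polyfunC _ _).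
by exists 'X_i => u; apply: mevalXU.
Qed.

Lemma polymap_sum U V (I : finType) (f : I -> U -> F) (v : I -> V) :
  (forall i, polyfun (f i)) -> polymap (fun u => \sum_i f i u *: v i).
Proof.
move=> pf j.
apply: polyfun_ext (polyfun_sum _ _ (fun i => polyfunM (pf i)
  (polyfunC _ (coord (vbasis {:V}) j (v i))))) => u.
by rewrite linear_sum; apply: eq_bigr => i _; rewrite linearZ.
Qed.

Lemma polymap_linear_comp U V W (f : U -> V) (g : 'Hom(V, W)) :
  polymap f -> polymap (fun u => g (f u)).
Proof.
move=> pf i.
pose b := vbasis {:V}.
apply: polyfun_ext (polyfun_sum _ _ (fun j => polyfunM (pf j)
  (polyfunC _ (coord (vbasis {:W}) i (g b`_j))))) => u.
rewrite [in RHS](coord_vbasis (memvf (f u))) !linear_sum; apply: eq_bigr => j _.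
by rewrite !linearZ.
Qed.

Lemma polymap_id U : polymap (@id U).
Proof. by move=> i; apply: polyfun_linear => a u v; rewrite linearP. Qed.

Lemma polymap_lfun U V (g : 'Hom(U, V)) : polymap g.
Proof. exact: polymap_linear_comp (@polymap_id U). Qed.

Lemma polyfun_comp U V (f : U -> V) (g : V -> F) :
  polymap f -> polyfun g -> polyfun (fun u => g (f u)).
Proof.
move=> /choice[t tE] [p pE]; exists (p \mPo [tuple t i | i < _]) => u.
rewrite -pE /evalpoly comp_mpoly_meval; apply: meval_eq => i.
by rewrite tnth_mktuple; apply: tE.
Qed.

(** Density of nonempty open sets: after multiplication by [D] the two functions agree everywhere,
    and [D] can be cancelled. *)
Lemma generic_eq U (f g : U -> F) : polyfun f -> polyfun g ->
  generically (fun u => f u = g u) -> f =1 g.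
Proof.
move=> [p pE] [q qE] [D D0 DE] u; rewrite -pE -qE.
suff -> : p = q by [].
apply: (mulfI D0); apply: evalpoly_inj => v; rewrite !evalpolyM.
by have [->|/DE E] := eqVneq (evalpoly D v) 0; rewrite ?mul0r // pE qE E.
Qed.

Lemma generically_polyfun U (f : U -> F) :
  polyfun f -> (exists u, f u != 0) -> generically (fun u => f u != 0).
Proof.
move=> [p pE] [u fu]; exists p => [|v]; last by rewrite pE.
by apply: contraNneq fu => p0; rewrite -pE p0 /evalpoly meval0.
Qed.

End PolynomialFunctions.

(** * Invariance of fractions, tested on values *)

Section InvariantRationalFunctions.
Variables (F : numFieldType) (U : vectType F) (G : groupType).
Variable rho : linrep G U.
Local Notation polyring := {mpoly F[\dim {:U}]}.
Local Notation "p %:F" := (@FracField.tofrac polyring p).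

Lemma frac_eqP (p q p' q' : polyring) : q != 0 -> q' != 0 ->
  (p%:F / q%:F = p'%:F / q'%:F) <->
  (forall u : U, evalpoly p u * evalpoly q' u = evalpoly p' u * evalpoly q u).
Proof.
move=> q0 q'0.
have -> : (p%:F / q%:F = p'%:F / q'%:F) <-> p * q' = p' * q.
  rewrite (rwP eqP) eqr_div ?tofrac_eq0 // -!tofracM tofrac_eq.
  by split=> /eqP.
split=> [E u|E]; first by rewrite -!evalpolyM E.
by apply: evalpoly_inj => u; rewrite !evalpolyM.
Qed.

Lemma evalpoly_act g p u : evalpoly (polyact rho g p) u = evalpoly p (rho g^-1%g u).
Proof. exact: evalpoly_pull. Qed.

Lemma inv_predP (p q : polyring) : q != 0 ->
  inv_pred rho (p%:F / q%:F) <->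
  (forall g u, evalpoly p (rho g u) * evalpoly q u
             = evalpoly p u * evalpoly q (rho g u)).
Proof.
move=> q0; split=> [/asboolP H g u|H].
  have := H g^-1%g; rewrite ratactE // frac_eqP ?polyact_eq0 // => /(_ u).
  by rewrite !evalpoly_act invgK.
apply/asboolP => g; rewrite ratactE // frac_eqP ?polyact_eq0 // => u.
by rewrite !evalpoly_act H.
Qed.

(* A denominator may vanish identically along [t]; moving numerator and
   denominator by a suitable group element repairs this. *)
Lemma inv_frac_nonvanishing (x : {fraction polyring}) (t : U -> U) :
  inv_pred rho x -> generically (fun u => exists g, t u = rho g u) ->
  exists p q, x = p%:F / q%:F /\ exists u, evalpoly q (t u) != 0.
Proof.
move=> /asboolP xinv ht.
have [p [q [q0 xE]]] : exists p q, q != 0 /\ x = p%:F / q%:F.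
  exists \n_(repr x), \d_(repr x); split; first exact: denom_ratioP.
  exact: ratfun_numden.
have [D D0 DE] := ht.
have [u] := evalpoly_nonroot (mulf_neq0 D0 q0).
rewrite evalpolyM mulf_eq0 negb_or => /andP[/DE[g tu] qu].
exists (polyact rho g p), (polyact rho g q); split.
  by rewrite -{1}(xinv g) xE ratactE.
by exists u; rewrite evalpoly_act tu -comp_lfunE -linrepM mulVg linrep1 id_lfunE.
Qed.

End InvariantRationalFunctions.

(** * Pulling back invariant rational functions *)


Section Pullback.
Variables (F : numFieldType) (U V : vectType F) (G H : groupType).
Variables (rhoU : linrep G U) (rhoV : linrep H V) (f : U -> V).
Hypothesis f_poly : polymap f.
Hypothesis f_equiv :
  forall g, generically (fun u => exists h, f (rhoU g u) = rhoV h (f u)).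
Local Notation polyU := {mpoly F[\dim {:U}]}.
Local Notation polyV := {mpoly F[\dim {:V}]}.
Local Notation "p %:F" := (FracField.tofrac p).

Lemma polypullback (p : polyV) :
  exists p' : polyU, forall u, evalpoly p' u = evalpoly p (f u).
Proof. by apply: polyfun_comp => //; exists p. Qed.

(* A relation: the fraction representing [x] has to be chosen with a denominator
   that does not vanish identically along [f]. *)
Definition ratpull (x : {fraction polyV}) (y : {fraction polyU}) :=
  exists (p q : polyV) (p' q' : polyU),
    [/\ x = p%:F / q%:F, y = p'%:F / q'%:F, exists u, evalpoly q (f u) != 0,
        forall u, evalpoly p' u = evalpoly p (f u) &
        forall u, evalpoly q' u = evalpoly q (f u)].

Lemma nonvanishing_neq0 (q : polyV) (u : U) : evalpoly q (f u) != 0 -> q != 0.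
Proof. by apply: contraNneq => ->; rewrite /evalpoly meval0. Qed.

Lemma nonvanishing_pull_neq0 (q : polyV) (q' : polyU) :
  (exists u, evalpoly q (f u) != 0) ->
  (forall u, evalpoly q' u = evalpoly q (f u)) -> q' != 0.
Proof.
by move=> [u qu] E; apply: contraNneq qu => q0; rewrite -E q0 /evalpoly meval0.
Qed.

Lemma ratpull_fun x y1 y2 : ratpull x y1 -> ratpull x y2 -> y1 = y2.
Proof.
move=> [p1 [q1 [p1' [q1' [x1 -> n1 pE1 qE1]]]]].
move=> [p2 [q2 [p2' [q2' [x2 -> n2 pE2 qE2]]]]].
have z1 := nonvanishing_pull_neq0 n1 qE1.
have z2 := nonvanishing_pull_neq0 n2 qE2.
case: n1 n2 => [u1 /nonvanishing_neq0 n1] [u2 /nonvanishing_neq0 n2].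
apply/(frac_eqP _ _ z1 z2) => u; rewrite pE1 pE2 qE1 qE2.
by apply: (iffLR (frac_eqP _ _ n1 n2)); rewrite -x1.
Qed.

Lemma ratpull_exists p q : (exists u, evalpoly q (f u) != 0) ->
  exists y, ratpull (p%:F / q%:F) y.
Proof.
move=> qf; have [p' pE] := polypullback p; have [q' qE] := polypullback q.
by exists (p'%:F / q'%:F), p, q, p', q'.
Qed.

Lemma ratpullB x1 x2 y1 y2 :
  ratpull x1 y1 -> ratpull x2 y2 -> ratpull (x1 - x2) (y1 - y2).
Proof.
move=> [p1 [q1 [p1' [q1' [-> -> n1 pE1 qE1]]]]].
move=> [p2 [q2 [p2' [q2' [-> -> n2 pE2 qE2]]]]].
have z1 := nonvanishing_pull_neq0 n1 qE1.
have z2 := nonvanishing_pull_neq0 n2 qE2.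
have := mulf_neq0 z1 z2; case: n1 n2 => [u1 /nonvanishing_neq0 n1].
move=> [u2 /nonvanishing_neq0 n2] /evalpoly_nonroot[u zu].
exists (p1 * q2 - p2 * q1), (q1 * q2), (p1' * q2' - p2' * q1'), (q1' * q2').
split.
- by rewrite -mulNr addf_div ?tofrac_eq0 // tofracB !tofracM mulNr.
- by rewrite -mulNr addf_div ?tofrac_eq0 // tofracB !tofracM mulNr.
- by exists u; rewrite evalpolyM -qE1 -qE2 -evalpolyM.
- by move=> v; rewrite !evalpolyB !evalpolyM pE1 pE2 qE1 qE2.
by move=> v; rewrite !evalpolyM qE1 qE2.
Qed.

Lemma ratpullM x1 x2 y1 y2 :
  ratpull x1 y1 -> ratpull x2 y2 -> ratpull (x1 * x2) (y1 * y2).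
Proof.
move=> [p1 [q1 [p1' [q1' [-> -> n1 pE1 qE1]]]]].
move=> [p2 [q2 [p2' [q2' [-> -> n2 pE2 qE2]]]]].
have z1 := nonvanishing_pull_neq0 n1 qE1.
have z2 := nonvanishing_pull_neq0 n2 qE2.
have := mulf_neq0 z1 z2; case: n1 n2 => [u1 /nonvanishing_neq0 n1].
move=> [u2 /nonvanishing_neq0 n2] /evalpoly_nonroot[u zu].
exists (p1 * p2), (q1 * q2), (p1' * p2'), (q1' * q2').
split; rewrite ?tofracM ?mulf_div //.
- by exists u; rewrite evalpolyM -qE1 -qE2 -evalpolyM.
- by move=> v; rewrite !evalpolyM pE1 pE2.
by move=> v; rewrite !evalpolyM qE1 qE2.
Qed.

Lemma ratpullC c : ratpull (ratfun_const V c) (ratfun_const U c).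
Proof.
exists c%:MP, 1, c%:MP, 1; split; rewrite ?tofrac1 ?divr1 //.
- by exists 0; rewrite /evalpoly meval1 oner_eq0.
- by move=> u; rewrite !evalpolyC.
by move=> u; rewrite /evalpoly !meval1.
Qed.

(** Cleared of denominators, invariance is a polynomial identity, so it is enough to check it where
    [f_equiv] provides [h]. *)
Lemma ratpull_inv x y : inv_pred rhoV x -> ratpull x y -> inv_pred rhoU y.
Proof.
move=> xinv [p [q [p' [q' [xE -> n pE qE]]]]].
have z := nonvanishing_pull_neq0 n qE.
case: n => u0 /nonvanishing_neq0 n.
rewrite xE in xinv; have {}xinv := iffLR (inv_predP rhoV p n) xinv.
apply/(inv_predP rhoU p' z) => g.
have evp (r : polyU) : polyfun (evalpoly r) by exists r.
have evg (r : polyU) : polyfun (fun u => evalpoly r (rhoU g u)).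
  by apply: polyfun_comp; [apply: polymap_lfun | exists r].
apply: generic_eq; try exact: polyfunM.
have [D D0 DE] := f_equiv g; exists D => // u /DE[h fh].
by rewrite !pE !qE fh xinv.
Qed.

End Pullback.

(** * Invariant fields of a space and of a slice in it *)

Section BirationalSlice.
Variables (F : numFieldType) (M N : vectType F) (H G : groupType).
Variables (rhoM : linrep H M) (rhoN : linrep G N).
Variables (i : M -> N) (s : N -> M).
Hypotheses (i_poly : polymap i) (s_poly : polymap s).
Hypothesis is_orbit : generically (fun n => exists g, i (s n) = rhoN g n).
Hypothesis si_orbit : generically (fun m => exists h, s (i m) = rhoM h m).
Hypothesis i_equiv :
  forall h, generically (fun m => exists g, i (rhoM h m) = rhoN g (i m)).
Hypothesis s_equiv :
  forall g, generically (fun n => exists h, s (rhoN g n) = rhoM h (s n)).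

(** The isomorphism is restriction along [i]. As a morphism of fields it is injective. A preimage of
    [y] is its pullback along [s], because [s (i m)] and [m] generically lie in one orbit and [y] is
    invariant. *)
Lemma invfield_iso :
  exists phi : {rmorphism invfield rhoN -> invfield rhoM},
    bijective phi /\ (forall c, phi (inv_scalar rhoN c) = inv_scalar rhoM c).
Proof.
have /choice[phi0 phiP] (x : invfield rhoN) :
    exists y : invfield rhoM, ratpull i (val x) (val y).
  (* A denominator that does not vanish identically along [i \o s] does not vanish identically along
     [i]. *)
  have [p [q [xE [n qn]]]] := inv_frac_nonvanishing (valP x) is_orbit.
  have [|y yx] := ratpull_exists i_poly p (q := q); first by exists (s n).
  rewrite -xE in yx.
  by exists (MkInvfield (ratpull_inv i_equiv (valP x) yx)).
have phiE x y : ratpull i (val x) (val y) -> phi0 x = y.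
  by move=> xy; apply/val_inj/(ratpull_fun (phiP x) xy).
have zP : zmod_morphism phi0.
  by move=> x y; apply: phiE; rewrite !rmorphB /=; apply: ratpullB; apply: phiP.
have cP c : phi0 (inv_scalar rhoN c) = inv_scalar rhoM c.
  by apply: phiE; apply: ratpullC.
have mP : monoid_morphism phi0.
  split=> [|x y]; last first.
    by apply: phiE; rewrite !rmorphM /=; apply: ratpullM; apply: phiP.
  have sc1 (U : vectType F) (K : groupType) (r : linrep K U) : inv_scalar r 1 = 1.
    by apply: val_inj; rewrite /= /ratfun_const mpolyC1 tofrac1.
  by rewrite -(sc1 _ _ rhoN) cP sc1.
pose Z := GRing.isZmodMorphism.Build _ _ _ zP.
pose Mu := GRing.isMonoidMorphism.Build _ _ _ mP.
pose phi : {rmorphism invfield rhoN -> invfield rhoM} := HB.pack phi0 Z Mu.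
exists phi; split; last exact: cP.
have surj y : exists x, phi x = y.
  have [p [q [yE qm]]] := inv_frac_nonvanishing (valP y) si_orbit.
  have [m qm0] := qm.
  have qs : exists n, evalpoly q (s n) != 0 by exists (i m).
  have [p' pE] := polypullback s_poly p; have [q' qE] := polypullback s_poly q.
  have xpull : ratpull s (val y) (FracField.tofrac p' / FracField.tofrac q').
    by exists p, q, p', q'.
  pose x : invfield rhoN := MkInvfield (ratpull_inv s_equiv (valP y) xpull).
  exists x; apply: phiE.
  have [p2 p2E] := polypullback i_poly p'; have [q2 q2E] := polypullback i_poly q'.
  exists p', q', p2, q2; split=> //; last by exists m; rewrite qE.
  have q20 : q2 != 0.
    by apply: contraNneq qm0 => z; rewrite -qE -q2E z /evalpoly meval0.
  have q0 := nonvanishing_neq0 qm0.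
  have yinv := valP y; rewrite yE in yinv *.
  have {}yinv := iffLR (inv_predP rhoM p q0) yinv.
  apply/(frac_eqP _ _ q0 q20).
  apply: generic_eq; try by apply: polyfunM; eexists.
  have [D D0 DE] := si_orbit; exists D => // u /DE[h fh].
  by rewrite p2E q2E pE qE fh yinv.
have [psi psiK] := choice surj.
by exists psi => // x; apply: (fmorph_inj phi); rewrite psiK.
Qed.

End BirationalSlice.

(** * Polarization of quadratic and cubic forms *)


Section Polarization.
Variable F : numFieldType.

Lemma mderiv_XU n (i j : 'I_n) : ('X_j : {mpoly F[n]})^`M(i) = (j == i)%:R.
Proof.
rewrite mderivX mnm1E; case: eqP => [->|_]; last by rewrite scale0r.
by rewrite -[X in (X - _)%MM]add0m addmK mpolyX0 scale1r.
Qed.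

(** The chain rule. By the Leibniz rule the property [P] is stable under products, which reduces it
    to the variables. *)
Lemma mderiv_subst m n (A : 'M[F]_(m, n)) (f : {mpoly F[n]}) i :
  (f \mPo subst_mx A)^`M(i) = \sum_j A i j *: (f^`M(j) \mPo subst_mx A).
Proof.
pose P (g : {mpoly F[n]}) :=
  (g \mPo subst_mx A)^`M(i) = \sum_j A i j *: (g^`M(j) \mPo subst_mx A).
have P1 : P 1.
  rewrite /P -mpolyC1 comp_mpolyC mderivC big1 // => j _.
  by rewrite mderivC comp_mpoly0 scaler0.
have PM g h : P g -> P h -> P (g * h).
  rewrite /P => Pg Ph; rewrite rmorphM /= mderivM Pg Ph.
  rewrite mulr_suml mulr_sumr -big_split; apply: eq_bigr => j _ /=.
  by rewrite mderivM rmorphD !rmorphM /= scalerDr scalerAl scalerAr.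
have PX a : P 'X_a.
  rewrite /P comp_mpolyXtnth tnth_mktuple (raddf_sum (mderiv _)) /=.
  rewrite (bigD1 i) //= big1 => [|k /negPf ki]; last first.
    by rewrite mderivZ mderiv_XU ki scaler0.
  rewrite (bigD1 a) //= big1 => [|k /negPf ka]; last first.
    by rewrite mderiv_XU eq_sym ka comp_mpoly0 scaler0.
  by rewrite mderivZ !mderiv_XU !eqxx !addr0 mulr1n -mpolyC1 comp_mpolyC.
suff PXm c : P 'X_[c].
  rewrite [f]mpolyE (raddf_sum (comp_mpoly _)) /= (raddf_sum (mderiv _)) /=.
  under eq_bigr => a _ do rewrite comp_mpolyZ mderivZ PXm scaler_sumr.
  rewrite exchange_big; apply: eq_bigr => j _ /=.
  rewrite (raddf_sum (mderiv _)) /= (raddf_sum (comp_mpoly _)) scaler_sumr.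
  apply: eq_bigr => a _ /=.
  by rewrite mderivZ comp_mpolyZ !scalerA mulrC.
rewrite mpolyXE_id; apply: (big_ind P) => // k _.
elim: (c k) => [|e IHe]; first by rewrite expr0.
by rewrite exprS; apply: PM (PX k) IHe.
Qed.

Lemma mnm_neq0P n (m : 'X_{1..n}) : m != 0%MM -> exists i, m i != 0%N.
Proof.
move/eqP => m0; apply: contrapT => H; apply: m0; apply/mnmP => i.
by rewrite mnm0E; apply/eqP/negP => /negP mi; apply: H; exists i.
Qed.

Lemma meval0_mcoeff n (f : {mpoly F[n]}) : f.@[fun=> 0] = f@_0.
Proof.
rewrite mevalE [in RHS](mpolyE f) (raddf_sum (mcoeff _)) /=.
apply: eq_bigr => m _; rewrite mcoeffZ mcoeffX; congr (_ * _).
have [->|/mnm_neq0P[i mi]] := eqVneq m 0%MM.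
  by rewrite big1 // => i _; rewrite mnm0E.
by rewrite (bigD1 i) //= expr0n (negPf mi) mul0r.
Qed.

Lemma meval0_subst m n (A : 'M[F]_(m, n)) (f : {mpoly F[n]}) :
  (f \mPo subst_mx A).@[fun=> 0] = f.@[fun=> 0].
Proof.
rewrite comp_mpoly_meval; apply: meval_eq => i.
rewrite tnth_mktuple raddf_sum big1 // => j _.
by rewrite /= mevalZ mevalXU mulr0.
Qed.

Lemma mderiv_homog n k (f : {mpoly F[n]}) i :
  f \is k.+1.-homog -> f^`M(i) \is k.-homog.
Proof.
move=> /dhomogP hf; apply/dhomogP => m; rewrite mcoeff_msupp mcoeff_mderiv.
move=> fm; suff /hf : (m + U_(i))%MM \in msupp f.
  by rewrite /= mdegD mdeg1 addn1 => -[].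
by rewrite mcoeff_msupp; apply: contraNneq fm => ->; rewrite mul0rn.
Qed.

(** A monomial of positive degree contains some variable; differentiating in it multiplies the
    coefficient by a nonzero integer, which is invertible in characteristic zero. *)
Lemma homog_mderiv_eq0 n k (f : {mpoly F[n]}) :
  f \is k.+1.-homog -> (forall i, f^`M(i) = 0) -> f = 0.
Proof.
move=> hf f0; apply/mpolyP => m; rewrite mcoeff0.
have [mk|] := eqVneq (mdeg m) k.+1; last exact: dhomog_nemf_coeff.
have [|i mi] := mnm_neq0P (m := m); first by rewrite -mdeg_eq0 mk.
have := mcoeff_mderiv i f (m - U_(i)); rewrite f0 mcoeff0 submK ?lep1mP // => /esym/eqP.
by rewrite mulrn_eq0 => /eqP.
Qed.

Lemma homog0_meval_eq0 n (f : {mpoly F[n]}) :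
  f \is 0.-homog -> f.@[fun=> 0] = 0 -> f = 0.
Proof.
move=> hf f0; apply/mpolyP => m; rewrite mcoeff0.
have [/eqP|] := eqVneq (mdeg m) 0%N; last exact: dhomog_nemf_coeff.
by rewrite mdeg_eq0 => /eqP->; rewrite -meval0_mcoeff f0.
Qed.

(** Polarization without the factor 1/2: for a quadratic form these are the entries of its constant
    Hessian. Likewise [polar3] carries no factor 1/6. *)
Definition polar2 n (f : {mpoly F[n]}) i j : F := f^`M(i)^`M(j).@[fun=> 0].
Definition polar3 n (f : {mpoly F[n]}) i j k : F :=
  f^`M(i)^`M(j)^`M(k).@[fun=> 0].

Lemma polar2C n (f : {mpoly F[n]}) i j : polar2 f i j = polar2 f j i.
Proof. by rewrite /polar2 mderiv_comm. Qed.

Lemma polar3C12 n (f : {mpoly F[n]}) i j k : polar3 f i j k = polar3 f j i k.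
Proof. by rewrite /polar3 (mderiv_comm i). Qed.

Lemma polar3C23 n (f : {mpoly F[n]}) i j k : polar3 f i j k = polar3 f i k j.
Proof. by rewrite /polar3 mderiv_comm. Qed.

Lemma polar2P n a (f g : {mpoly F[n]}) i j :
  polar2 (a *: f + g) i j = a * polar2 f i j + polar2 g i j.
Proof. by rewrite /polar2 !(mderivD, mderivZ) mevalD mevalZ. Qed.

Lemma polar3P n a (f g : {mpoly F[n]}) i j k :
  polar3 (a *: f + g) i j k = a * polar3 f i j k + polar3 g i j k.
Proof. by rewrite /polar3 !(mderivD, mderivZ) mevalD mevalZ. Qed.

Lemma polar2Z n a (f : {mpoly F[n]}) i j :
  polar2 (a *: f) i j = a * polar2 f i j.
Proof. by rewrite /polar2 !mderivZ mevalZ. Qed.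

Lemma polar3Z n a (f : {mpoly F[n]}) i j k :
  polar3 (a *: f) i j k = a * polar3 f i j k.
Proof. by rewrite /polar3 !mderivZ mevalZ. Qed.

Lemma polar3_sum n (I : Type) (r : seq I) (f : I -> {mpoly F[n]}) i j k :
  polar3 (\sum_(x <- r) f x) i j k = \sum_(x <- r) polar3 (f x) i j k.
Proof.
rewrite /polar3 (raddf_sum (mderiv i)) (raddf_sum (mderiv j)).
by rewrite (raddf_sum (mderiv k)) raddf_sum.
Qed.

Lemma polar2_sum n (I : Type) (r : seq I) (f : I -> {mpoly F[n]}) i j :
  polar2 (\sum_(x <- r) f x) i j = \sum_(x <- r) polar2 (f x) i j.
Proof.
by rewrite /polar2 (raddf_sum (mderiv i)) (raddf_sum (mderiv j)) raddf_sum.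
Qed.

Lemma polar2_eq0 n (f : {mpoly F[n]}) :
  f \is 2.-homog -> (forall i j, polar2 f i j = 0) -> f = 0.
Proof.
move=> hf f0; apply: homog_mderiv_eq0 (hf) _ => i.
apply: homog_mderiv_eq0 (mderiv_homog i hf) _ => j.
by apply: homog0_meval_eq0 (f0 i j); do 2!apply: mderiv_homog.
Qed.

Lemma polar3_eq0 n (f : {mpoly F[n]}) :
  f \is 3.-homog -> (forall i j k, polar3 f i j k = 0) -> f = 0.
Proof.
move=> hf f0; apply: homog_mderiv_eq0 (hf) _ => i.
by apply: polar2_eq0 (f0 i); apply: mderiv_homog.
Qed.

Lemma polar2_XX n (a b i j : 'I_n) :
  polar2 ('X_a * 'X_b) i j
  = (a == i)%:R * (b == j)%:R + (a == j)%:R * (b == i)%:R.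
Proof.
rewrite /polar2 mderivM !mderiv_XU.
rewrite !mulr_natl !mulr_natr mderivD !mderivMn !mderiv_XU.
by rewrite mevalD !mevalMn meval1 -!mulrnA [((a == j) * _)%N]mulnC.
Qed.

Lemma polar3_XM n a (q : {mpoly F[n]}) i j k :
  polar3 ('X_a * q) i j k = (a == i)%:R * polar2 q j k
    + (a == j)%:R * polar2 q i k + (a == k)%:R * polar2 q i j.
Proof.
rewrite /polar3 /polar2 mderivM mderiv_XU mulr_natl.
rewrite mderivD mderivMn mderivM mderiv_XU mulr_natl.
rewrite !mderivD !mderivMn mderivM mderiv_XU mulr_natl.
rewrite !mevalD !mevalMn mevalM mevalXU mul0r addr0 !mulr_natl.
by rewrite addrA.
Qed.

Lemma sum_delta (I : finType) (f : I -> F) i : \sum_a (a == i)%:R * f a = f i.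
Proof.
rewrite (bigD1 i) //= eqxx mul1r big1 ?addr0 // => a /negPf ->.
by rewrite mul0r.
Qed.

(** The factor 1/6 compensates for the six ways of matching three derivatives with three
    variables. *)
Definition cubic n (t : 'I_n -> 'I_n -> 'I_n -> F) : {mpoly F[n]} :=
  \sum_a \sum_b \sum_c (6^-1 * t a b c) *: ('X_a * ('X_b * 'X_c)).

Lemma cubic_homog n (t : 'I_n -> 'I_n -> 'I_n -> F) : cubic t \is 3.-homog.
Proof.
rewrite !rpred_sum // => a _; rewrite rpred_sum // => b _.
rewrite rpred_sum // => c _; apply: dhomogZ.
have hX (e : 'I_n) : ('X_e : {mpoly F[n]}) \is 1.-homog.
  by rewrite dhomogX; apply/eqP/mdeg1.
by apply: (@dhomogM _ _ _ 1 _ 2) => //; apply: (@dhomogM _ _ _ 1 _ 1).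
Qed.

Lemma polar3_cubic n (t : 'I_n -> 'I_n -> 'I_n -> F) i j k :
  (forall a b c, t a b c = t b a c) -> (forall a b c, t a b c = t a c b) ->
  polar3 (cubic t) i j k = t i j k.
Proof.
move=> t12 t23.
have S a b c : \sum_a' \sum_b' \sum_c'
    (a' == a)%:R * ((b' == b)%:R * ((c' == c)%:R * t a' b' c')) = t a b c.
  under eq_bigr => a' _.
    under eq_bigr => b' _ do rewrite -!mulr_sumr sum_delta.
    rewrite -mulr_sumr sum_delta; over.
  by rewrite sum_delta.
(* The value is written as the mean over the six permutations; [S] then expands each term into
   Kronecker deltas, and the two sides are compared summand by summand. *)
have -> : t i j k = 6^-1 * (t i j k + t i k j + t j i k + t j k i + t k i j + t k j i).
  rewrite -(t23 i j k) -(t12 i j k) (t23 j k i) -(t12 i j k).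
  rewrite -(t12 i k j) -(t23 i j k) (t12 k j i) (t23 j k i) -(t12 i j k).
  have -> : t i j k + t i j k + t i j k + t i j k + t i j k + t i j k = 6 * t i j k.
    by rewrite mulr_natl !mulrS mulr0n addr0 !addrA.
  by rewrite mulKf ?pnatr_eq0.
rewrite -!S -!big_split mulr_sumr polar3_sum; apply: eq_bigr => a _.
rewrite -!big_split mulr_sumr polar3_sum; apply: eq_bigr => b _.
rewrite -!big_split mulr_sumr polar3_sum; apply: eq_bigr => c _ /=.
rewrite polar3Z polar3_XM !polar2_XX.
ring.
Qed.

Lemma polar3_subst m n (A : 'M[F]_(m, n)) (f : {mpoly F[n]}) i j k :
  polar3 (f \mPo subst_mx A) i j k =
  \sum_a A i a * \sum_b \sum_c A j b * A k c * polar3 f a b c.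
Proof.
rewrite /polar3 mderiv_subst (raddf_sum (mderiv j)) /=.
rewrite (raddf_sum (mderiv k)) (raddf_sum (meval _)) /=.
apply: eq_bigr => a _; rewrite !mderivZ mevalZ; congr (_ * _).
rewrite mderiv_subst (raddf_sum (mderiv k)) (raddf_sum (meval _)) /=.
apply: eq_bigr => b _; rewrite mderivZ mevalZ mderiv_subst (raddf_sum (meval _)).
rewrite mulr_sumr; apply: eq_bigr => c _ /=.
by rewrite mevalZ meval0_subst mulrA.
Qed.

End Polarization.

(** * Nets as triples of symmetric matrices *)


Section NetMatrices.
Variables (F : numFieldType) (d : nat).
Local Notation nets := 'Hom(symv F 2 d, 'cV[F]_3).
Implicit Types (n : nets) (Q : 'I_3 -> 'M[F]_d).

Fact quad_homog (j k : 'I_d) : ('X_j * 'X_k : {mpoly F[d]}) \is 2.-homog.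
Proof.
have hX (e : 'I_d) : ('X_e : {mpoly F[d]}) \is 1.-homog.
  by rewrite dhomogX; apply/eqP/mdeg1.
exact: (@dhomogM _ _ _ 1 _ 1).
Qed.

Definition quad j k : symv F 2 d := DHomog (quad_homog j k).

(** Both sides are quadratic forms with the same second derivatives; the 1/2 accounts for summing
    over ordered pairs. *)
Lemma quad_decomp (u : symv F 2 d) :
  u = \sum_j \sum_k (2^-1 * polar2 (val u) j k) *: quad j k.
Proof.
apply: val_inj; rewrite raddf_sum /=.
under eq_bigr => j _ do rewrite raddf_sum /=.
apply/eqP; rewrite -subr_eq0; apply/eqP/polar2_eq0 => [|i j].
  rewrite rpredB ?dhomog_is_dhomog // rpred_sum // => j _.
  by rewrite rpred_sum // => k _; apply: dhomogZ; apply: quad_homog.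
rewrite -scaleN1r addrC polar2P polar2_sum.
under eq_bigr => a _ do rewrite polar2_sum.
suff -> : \sum_a \sum_b polar2
    ((2^-1 * polar2 (val u) a b) *: ('X_a * 'X_b)) i j = polar2 (val u) i j.
  by rewrite mulN1r addNr.
transitivity (2^-1 * (polar2 (val u) i j + polar2 (val u) j i)); last first.
  by rewrite (polar2C _ j i); field.
have S a b : \sum_a' \sum_b'
    (a' == a)%:R * ((b' == b)%:R * polar2 (val u) a' b') = polar2 (val u) a b.
  under eq_bigr => a' _ do rewrite -mulr_sumr sum_delta.
  by rewrite sum_delta.
rewrite -!S -big_split mulr_sumr; apply: eq_bigr => a _.
rewrite -big_split mulr_sumr; apply: eq_bigr => b _ /=.
rewrite polar2Z polar2_XX; ring.
Qed.

(** The Gram matrix of the [i]-th quadric of the net. *)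
Definition qmx n (i : 'I_3) : 'M[F]_d := \matrix_(j, k) n (quad j k) i 0.

Lemma qmx_inj n n' : qmx n =1 qmx n' -> n = n'.
Proof.
move=> E; apply/lfunP => u; rewrite (quad_decomp u) !linear_sum /=.
apply: eq_bigr => j _; rewrite !linear_sum; apply: eq_bigr => k _ /=.
rewrite !linearZ; congr (_ *: _); apply/colP => i.
by have /matrixP/(_ j k) := E i; rewrite !mxE.
Qed.

Lemma qmx_sym n i : (qmx n i)^T = qmx n i.
Proof.
apply/matrixP => j k; rewrite !mxE; congr (n _ i 0).
by apply: val_inj; rewrite /= mulrC.
Qed.

Lemma qmxP a n n' i : qmx (a *: n + n') i = a *: qmx n i + qmx n' i.
Proof. by apply/matrixP => j k; rewrite !mxE add_lfunE scale_lfunE !mxE. Qed.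

Lemma qmxZ a n i : qmx (a *: n) i = a *: qmx n i.
Proof. by apply/matrixP => j k; rewrite !mxE scale_lfunE !mxE. Qed.

Lemma qmx_sum (I : Type) (r : seq I) (f : I -> nets) i :
  qmx (\sum_(x <- r) f x) i = \sum_(x <- r) qmx (f x) i.
Proof.
elim: r => [|x r IHr].
  by rewrite !big_nil; apply/matrixP => j k; rewrite !mxE zero_lfunE mxE.
by rewrite !big_cons -IHr -[f x]scale1r qmxP !scale1r.
Qed.

Definition unit_net_fun (i : 'I_3) (j k : 'I_d) (u : symv F 2 d) : 'cV[F]_3 :=
  polar2 (val u) j k *: delta_mx i 0.

Fact unit_net_fun_linear i j k : linear (unit_net_fun i j k).
Proof. by move=> a u v; rewrite /unit_net_fun polar2P scalerDl scalerA. Qed.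
HB.instance Definition _ i j k :=
  GRing.isLinear.Build F (symv F 2 d) 'cV[F]_3 *:%R (unit_net_fun i j k)
    (unit_net_fun_linear i j k).

Definition unit_net i j k : nets := linfun (unit_net_fun i j k).

Lemma qmx_unit_net i j k i' :
  qmx (unit_net i j k) i' = (i' == i)%:R *: (delta_mx j k + delta_mx k j).
Proof.
apply/matrixP => a b; rewrite !mxE lfunE /= !mxE polar2_XX andbT mulrC.
by rewrite -!natrM !mulnb.
Qed.

(** The inverse of [qmx] on triples of symmetric matrices; the 1/2 is there because [unit_net] has
    two symmetric entries. *)
Definition net_of Q : nets :=
  \sum_(x : 'I_3 * 'I_d * 'I_d)
    (2^-1 * Q x.1.1 x.1.2 x.2) *: unit_net x.1.1 x.1.2 x.2.

Lemma qmx_net_of Q i : (forall i, (Q i)^T = Q i) -> qmx (net_of Q) i = Q i.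
Proof.
move=> Qs; rewrite /net_of qmx_sum.
pose f i' j k : 'M[F]_d :=
  (2^-1 * Q i' j k) *: ((i == i')%:R *: (delta_mx j k + delta_mx k j)).
transitivity (\sum_i' \sum_j \sum_k f i' j k).
  rewrite !pair_bigA /=; apply: eq_bigr => -[[i' j] k] _ /=.
  by rewrite qmxZ qmx_unit_net.
rewrite (bigD1 i) //= [X in _ + X]big1 ?addr0 => [|i' /negPf ii']; last first.
  rewrite big1 // => j _; rewrite big1 // => k _.
  by rewrite /f eq_sym ii' scale0r scaler0.
have E : Q i = 2^-1 *: (Q i + (Q i)^T).
  by rewrite Qs -mulr2n -[Q i *+ 2]scaler_nat scalerA mulVf ?scale1r ?pnatr_eq0.
rewrite [RHS]E {1}[Q i in RHS]matrix_sum_delta [X in X^T]matrix_sum_delta.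
rewrite raddf_sum -big_split scaler_sumr; apply: eq_bigr => j _ /=.
rewrite raddf_sum -big_split scaler_sumr; apply: eq_bigr => k _ /=.
by rewrite /f eqxx scale1r linearZ /= trmx_delta -scalerDr scalerA.
Qed.

(* [B^T *m Q l *m B] is the pullback of the quadric [Q l] along [B]. *)
Definition tr (h : 'M[F]_3) (B : 'M[F]_d) Q i :=
  \sum_l h i l *: (B^T *m Q l *m B).

Lemma tr_tr h B h' B' Q : tr h B (tr h' B' Q) =1 tr (h *m h') (B' *m B) Q.
Proof.
move=> i; rewrite /tr.
under eq_bigr => l _.
  rewrite mulmx_sumr mulmx_suml scaler_sumr.
  under eq_bigr => k _ do
    rewrite -scalemxAr -scalemxAl scalerA !mulmxA -[_ *m B' *m B]mulmxA -trmx_mul.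
  over.
rewrite exchange_big; apply: eq_bigr => k _ /=.
by rewrite mxE scaler_suml.
Qed.

Lemma tr1 B Q : tr 1%:M B Q =1 (fun i => B^T *m Q i *m B).
Proof.
move=> i; rewrite /tr (bigD1 i) //= [X in X *: _]mxE eqxx scale1r.
by rewrite big1 ?addr0 // => l /negPf li; rewrite mxE eq_sym li scale0r.
Qed.

Lemma tr_ext h B Q Q' : Q =1 Q' -> tr h B Q =1 tr h B Q'.
Proof. by move=> E i; apply: eq_bigr => l _; rewrite E. Qed.

Lemma tr_sym h B Q : (forall i, (Q i)^T = Q i) -> forall i, (tr h B Q i)^T = tr h B Q i.
Proof.
move=> Qs i; rewrite raddf_sum; apply: eq_bigr => l _ /=.
by rewrite linearZ /= !trmx_mul trmxK Qs mulmxA.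
Qed.

(** The action is linear in [h] and quadratic in [B]. This allows both to be rescaled to determinant
    one. *)
Lemma trZ h B Q a b :
  tr (a *: h) (b *: B) Q =1 (fun i => (a * b ^+ 2) *: tr h B Q i).
Proof.
move=> i; rewrite scaler_sumr; apply: eq_bigr => l _.
rewrite mxE [(b *: B)^T]linearZ /= -!scalemxAl -scalemxAr !scalerA.
by congr (_ *: _); ring.
Qed.

Lemma symmap_quad (A : 'M[F]_d) j k :
  symmap 2 A (quad j k) = \sum_a \sum_b (A a j * A b k) *: quad a b.
Proof.
apply: val_inj; rewrite symmapE raddf_sum /= rmorphM /= !comp_mpolyXtnth.
rewrite !tnth_mktuple mulr_suml; apply: eq_bigr => a _.
rewrite raddf_sum mulr_sumr; apply: eq_bigr => b _ /=.
by rewrite -scalerAl -scalerAr scalerA.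
Qed.

Lemma qmx_netrep g h c n :
  qmx (netrep F d (g, h, c) n) =1
  tr (val c *: val (val h)) (val (val (g^-1)%g)) (qmx n).
Proof.
move=> i; apply/matrixP => j k; rewrite mxE lin_netactE netactE.
rewrite symmap_quad mxE mxE mulr_sumr summxE; apply: eq_bigr => l _.
rewrite [RHS]mxE [X in _ = X * _]mxE mulrA; congr (_ * _).
rewrite [RHS]mxE linear_sum summxE.
under eq_bigr => a _ do rewrite linear_sum summxE.
rewrite exchange_big; apply: eq_bigr => b _ /=.
rewrite mxE mulr_suml; apply: eq_bigr => a _.
by rewrite linearZ !mxE mulrAC.
Qed.

End NetMatrices.

(** * The kernel of a net *)


Lemma I3_addK (i : 'I_3) : i + 1 + 1 + 1 = i.
Proof. by rewrite -!addrA (_ : 1 + (1 + 1) = 0) ?addr0 //; apply: val_inj. Qed.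

Section NetKernel.
Variables (F : numFieldType) (d : nat).
Implicit Types (Q : 'I_3 -> 'M[F]_d) (V W : 'M[F]_(3, d)).

Definition netker Q V := forall i j, row i V *m Q j = row j V *m Q i.

(** The kernel has dimension at most one, so any nonzero element of it spans it. *)
Definition netker_line Q :=
  exists V, forall W, netker Q W -> exists c, W = c *: V.

Lemma netkerZ Q c V : netker Q V -> netker Q (c *: V).
Proof. by move=> kV i j; rewrite !linearZ -!scalemxAl /= kV. Qed.

Lemma netkerB Q V W : netker Q V -> netker Q W -> netker Q (V - W).
Proof. by move=> kV kW i j; rewrite !linearB !mulmxBl /= kV kW. Qed.

Lemma netker_ext Q Q' V : Q =1 Q' -> netker Q V -> netker Q' V.
Proof. by move=> E kV i j; rewrite -!E. Qed.

(** The inverse of [B] on the vectors cancels one factor [B] of each quadric. What remains is a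
    double sum with coefficients [h j l * h i k], which the kernel equations make symmetric in [i]
    and [j]. *)
Lemma netker_tr (h : 'M[F]_3) (B : 'M[F]_d) Q V : B \in unitmx ->
  netker Q V -> netker (tr h B Q) (h *m V *m (invmx B)^T).
Proof.
move=> uB kV.
have E i j : row i (h *m V *m (invmx B)^T) *m tr h B Q j =
    \sum_l \sum_k (h j l * h i k) *: (row k V *m Q l *m B).
  rewrite mulmx_sumr; apply: eq_bigr => l _.
  rewrite !row_mul [row i h *m V]mulmx_sum_row -scalemxAr !mulmxA.
  rewrite -[_ *m (invmx B)^T *m B^T]mulmxA -trmx_mul mulmxV // trmx1 mulmx1.
  rewrite !mulmx_suml scaler_sumr; apply: eq_bigr => k _.
  by rewrite -!scalemxAl scalerA mxE.
move=> i j; rewrite !E exchange_big; apply: eq_bigr => l _ /=.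
by apply: eq_bigr => k _; rewrite kV mulrC.
Qed.

Lemma netker_line_tr (h : 'M[F]_3) (B : 'M[F]_d) Q :
  h \in unitmx -> B \in unitmx -> netker_line Q -> netker_line (tr h B Q).
Proof.
move=> uh uB [V HV]; exists (h *m V *m (invmx B)^T) => W kW.
have kW' : netker Q (invmx h *m W *m B^T).
  have uB' : invmx B \in unitmx by rewrite unitmx_inv.
  have := netker_tr (invmx h) uB' kW.
  rewrite invmxK; apply: netker_ext => i.
  by rewrite tr_tr mulVmx // mulmxV // tr1 trmx1 mul1mx mulmx1.
have [c Wc] := HV _ kW'; exists c.
have -> : W = h *m (invmx h *m W *m B^T) *m (invmx B)^T.
  rewrite !mulmxA -[_ *m B^T *m _]mulmxA -trmx_mul mulVmx // trmx1 mulmx1.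
  by rewrite mulmxV // mul1mx.
by rewrite Wc -scalemxAr -scalemxAl.
Qed.

(* Cross product of the triple of rows of [V] with [Q]; indices are taken mod 3. *)
Definition kermap Q V : 'M[F]_(3, d) :=
  \matrix_i (row (i + 1) V *m Q (i + 1 + 1) - row (i + 1 + 1) V *m Q (i + 1)).

Fact kermap_linear Q : linear (kermap Q).
Proof.
move=> a V W; apply/row_matrixP => i; rewrite linearP /= !rowK !linearP /=.
by rewrite !mulmxDl -!scalemxAl opprD scalerBr addrACA.
Qed.
HB.instance Definition _ Q :=
  GRing.isLinear.Build F 'M[F]_(3, d) 'M[F]_(3, d) *:%R (kermap Q)
    (kermap_linear Q).

(** Of two distinct indices mod 3 one is the successor of the other, so the three cyclic equations
    contain all of them. *)
Lemma kermapP Q V : kermap Q V = 0 <-> netker Q V.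
Proof.
split=> [K0|kV]; last first.
  by apply/row_matrixP => i; rewrite rowK kV subrr row0.
have E l : row (l + 1) V *m Q (l + 1 + 1) = row (l + 1 + 1) V *m Q (l + 1).
  by apply/eqP; rewrite -subr_eq0; have := congr1 (row l) K0; rewrite rowK row0 => ->.
move=> i j; have [->//|ij] := eqVneq i j.
have {ij} [->|->] : j = i + 1 \/ i = j + 1.
  by case: i j ij => [[|[|[|//]]] ?] [[|[|[|//]]] ?] //= _;
    (by left; apply: val_inj) || (by right; apply: val_inj).
- by have := E (i + 1 + 1); rewrite I3_addK.
by have := E (j + 1 + 1); rewrite I3_addK.
Qed.

(** The trace pairing is [S V W - S W V] for a bilinear form [S]; the symmetry of the [Q i] is what
    turns the second half of the cross product into [S W V]. *)
Lemma kermap_skew Q V W : (forall i, (Q i)^T = Q i) ->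
  \tr (kermap Q V *m W^T) = - \tr (kermap Q W *m V^T).
Proof.
move=> Qs.
pose S V W := \sum_i (row i V *m Q (i + 1) *m (row (i + 1 + 1) W)^T) 0 0.
suff E V' W' : \tr (kermap Q V' *m W'^T) = S V' W' - S W' V'.
  by rewrite !E opprB.
transitivity (\sum_i (row i (kermap Q V') *m (row i W')^T) 0 0).
  by apply: eq_bigr => i _; rewrite !mxE; apply: eq_bigr => k _; rewrite !mxE.
have -> : S W' V' = \sum_i (row (i + 1 + 1) V' *m Q (i + 1) *m (row i W')^T) 0 0.
  apply: eq_bigr => i _.
  rewrite -[in RHS](Qs (i + 1)) -[in RHS](trmxK (row (i + 1 + 1) V')).
  by rewrite -!trmx_mul mulmxA [RHS]mxE.
have -> : S V' W' = \sum_i (row (i + 1) V' *m Q (i + 1 + 1) *m (row i W')^T) 0 0.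
  rewrite /S (reindex_inj (addIr (1 : 'I_3))); apply: eq_bigr => i _ /=.
  by rewrite I3_addK.
rewrite -sumrB; apply: eq_bigr => i _.
by rewrite rowK mulmxBl [LHS]mxE [X in _ + X]mxE.
Qed.

End NetKernel.

(** * A polynomial formula for a generator of the kernel *)

Section KernelVector.
Variables (F : numFieldType) (d : nat) (hd : (3 <= d)%N).
Implicit Types (Q : 'I_3 -> 'M[F]_d) (V W : 'M[F]_(3, d)).

Definition wid : 'I_3 -> 'I_d := widen_ord hd.
Definition std : 'M[F]_(3, d) := rowsub wid 1%:M.

Lemma trace_delta m n c (i : 'I_m) (j : 'I_n) (V : 'M[F]_(m, n)) :
  \tr (c *: delta_mx i j *m V^T) = c * V i j.
Proof.
rewrite -scalemxAl linearZ /= /mxtrace (bigD1 i) //= big1 => [|k /negPf ki].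
  rewrite addr0 mxE (bigD1 j) //= big1 => [|k /negPf kj].
    by rewrite !mxE !eqxx mul1r addr0.
  by rewrite !mxE kj andbF mul0r.
by rewrite mxE big1 // => l _; rewrite !mxE ki mul0r.
Qed.

Lemma wid_inj : injective wid.
Proof. by move=> i j /(congr1 val) /= E; apply: val_inj. Qed.

Lemma stdE i j : std i j = (wid i == j)%:R.
Proof. by rewrite !mxE. Qed.

Lemma mul_std n (X : 'M[F]_(d, n)) : std *m X = rowsub wid X.
Proof. by rewrite mul_rowsub_mx mul1mx. Qed.

(* Away from its (0,0) entry this is [kermap Q]; the skew-symmetry of [kermap]
   makes the equation that is dropped redundant as soon as [V 0 (wid 0) != 0]. *)
Definition bordered Q V : 'M[F]_(3, d) :=
  kermap Q V + (V 0 (wid 0) - kermap Q V 0 (wid 0)) *: delta_mx 0 (wid 0).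

Fact bordered_linear Q : linear (bordered Q).
Proof.
move=> a V W; rewrite /bordered linearP /= !mxE.
rewrite scalerDr [a *: (_ *: _)]scalerA addrACA -scalerDl.
by congr (_ + _ *: _); ring.
Qed.
HB.instance Definition _ Q :=
  GRing.isLinear.Build F 'M[F]_(3, d) 'M[F]_(3, d) *:%R (bordered Q)
    (bordered_linear Q).

Definition kerdet Q : F := \det (lin_mx (bordered Q)).

(** Cramer's rule for the equation of [bordered_kervec]. The adjugate avoids division, so the
    entries are polynomial in [Q]. *)
Definition kervec Q : 'M[F]_(3, d) :=
  vec_mx (mxvec (delta_mx 0 (wid 0)) *m \adj (lin_mx (bordered Q))).

Lemma bordered_kervec Q : bordered Q (kervec Q) = kerdet Q *: delta_mx 0 (wid 0).
Proof.
apply: (can_inj mxvecK); rewrite -mul_vec_lin /kervec vec_mxK.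
by rewrite -mulmxA mul_adj_mx mul_mx_scalar linearZ.
Qed.

Lemma bordered_eq0 Q W : kerdet Q != 0 -> bordered Q W = 0 -> W = 0.
Proof.
move=> D0 W0; apply/eqP; rewrite -mxvec_eq0; apply: contraTT D0 => WN0.
rewrite negbK; apply/det0P; exists (mxvec W) => //.
by rewrite mul_vec_lin /= W0 linear0.
Qed.

Lemma kervec00 Q : kervec Q 0 (wid 0) = kerdet Q.
Proof.
have /matrixP/(_ 0 (wid 0)) := bordered_kervec Q; rewrite !mxE !eqxx.
by rewrite !mulr1 addrC subrK.
Qed.

(** Only the corner entry [c] of [kermap Q (kervec Q)] may be nonzero. Skew-symmetry makes its
    pairing with [kervec Q] vanish, and this pairing is [c * kerdet Q]. *)
Lemma kervec_netker Q : (forall i, (Q i)^T = Q i) -> kerdet Q != 0 ->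
  netker Q (kervec Q).
Proof.
move=> Qs D0; apply/kermapP.
set c := kermap Q (kervec Q) 0 (wid 0).
have E : kermap Q (kervec Q) = c *: delta_mx 0 (wid 0).
  have := bordered_kervec Q; rewrite /bordered kervec00 -/c => /(canRL (addrK _)) ->.
  by rewrite -scalerBl subKr.
suff c0 : c = 0 by rewrite E c0 scale0r.
have := kermap_skew (kervec Q) (kervec Q) Qs.
move/eqP; rewrite -addr_eq0 -mulr2n mulrn_eq0 /= E trace_delta kervec00.
by rewrite mulf_eq0 (negPf D0) orbF => /eqP.
Qed.

(** The difference of the two sides lies in the kernel and has corner entry 0, so the injective map
    [bordered Q] sends it to 0. *)
Lemma netker_kervec Q W : (forall i, (Q i)^T = Q i) -> kerdet Q != 0 ->
  netker Q W -> W = (W 0 (wid 0) / kerdet Q) *: kervec Q.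
Proof.
move=> Qs D0 kW; apply/eqP; rewrite -subr_eq0; apply/eqP/(bordered_eq0 D0).
have /kermapP K0 : netker Q (W - (W 0 (wid 0) / kerdet Q) *: kervec Q).
  by apply/netkerB/netkerZ/kervec_netker.
rewrite /bordered K0 [X in X - _]mxE [X in _ + X - _]mxE [X in _ - X - _]mxE.
by rewrite kervec00 divfK // subrr mxE subr0 scale0r addr0.
Qed.

End KernelVector.

(** * Cubic forms and nets *)


Section CubicNets.
Variables (F : numFieldType) (d : nat) (hd : (3 <= d)%N).
Local Notation nets := 'Hom(symv F 2 d, 'cV[F]_3).
Local Notation cubics := (symv F 3 d).
Local Notation wid := (wid hd).
Local Notation std := (std F hd).
Implicit Types (Q : 'I_3 -> 'M[F]_d) (f : cubics).

Lemma wid_lt (i : 'I_3) : (wid i < 3)%N.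
Proof. exact: (ltn_ord i). Qed.

Lemma widP (j : 'I_d) : (j < 3)%N -> exists i, j = wid i.
Proof. by move=> j3; exists (Ordinal j3); apply: val_inj. Qed.

Lemma sum_wid (V : nmodType) (g : 'I_d -> V) :
  (forall j : 'I_d, (3 <= j)%N -> g j = 0) ->
  \sum_j g j = \sum_i g (wid i).
Proof.
move=> g0; rewrite (bigID (fun j : 'I_d => (j < 3)%N)) /=.
rewrite [X in _ + X]big1 ?addr0 => [|j]; last by rewrite -leqNgt => /g0.
by rewrite (big_ord_narrow hd).
Qed.

(* For [i < 3], the Hessian matrix of the [i]-th partial derivative of [f]. *)
Definition polmx f (i : 'I_3) : 'M[F]_d :=
  \matrix_(j, k) polar3 (val f) (wid i) j k.

Lemma polmx_sym f i : (polmx f i)^T = polmx f i.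
Proof. by apply/matrixP => j k; rewrite !mxE polar3C23. Qed.

Lemma row_std i (M : 'M[F]_d) : row i std *m M = row (wid i) M.
Proof. by rewrite -row_mul mul_std; apply/rowP => k; rewrite !mxE. Qed.

Lemma polmx_netker f : netker (polmx f) std.
Proof.
move=> i j; rewrite !row_std.
by apply/rowP => k; rewrite !mxE polar3C12.
Qed.

(** The symmetry of the matrices and the kernel equations at the standard triple say that the
    entries of [Q] form part of a symmetric 3-tensor, which comes from a cubic. *)
Lemma polmx_onto Q : (forall i, (Q i)^T = Q i) -> netker Q std ->
  exists f, polmx f =1 Q.
Proof.
move=> Qs kQ.
have sQ i j k : Q i j k = Q i k j by rewrite -[in LHS]Qs mxE.
have cQ i j k : Q i (wid j) k = Q j (wid i) k.
  by have /rowP/(_ k) := kQ j i; rewrite !row_std !mxE.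
(* The entry is read off at the first index below 3. Entries with no such index are free modulo
   Sym^3(F) and are set to 0. *)
pose t (a b c : 'I_d) : F :=
  if insub (val a) is Some i then Q i b c else
  if insub (val b) is Some i then Q i a c else
  if insub (val c) is Some i then Q i a b else 0.
have insE (a : 'I_d) : {i | a = wid i & insub (val a) = Some i} +
    {insub (val a) = None :> option 'I_3}.
  case: insubP => [i _ ia|_]; last by right.
  by left; exists i => //; apply: val_inj.
have t12 a b c : t a b c = t b a c.
  rewrite /t; case: (insE a) => [[i -> ->]|->]; case: (insE b) => [[j -> ->]|->] //.
  by case: insubP => // *; apply: sQ.
have t23 a b c : t a b c = t a c b.
  rewrite /t; case: (insE a) => [[i -> ->]|->]; first exact: sQ.
  case: (insE b) => [[j -> ->]|->]; case: (insE c) => [[k -> ->]|->] //.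
  by rewrite sQ cQ sQ.
exists (DHomog (cubic_homog t)) => i; apply/matrixP => j k.
rewrite mxE /= polar3_cubic //.
by rewrite /t /= valK.
Qed.

Definition hblock (p : 'M[F]_d) : 'M[F]_3 := \matrix_(i, l) p (wid i) (wid l).

(** The vanishing block of [p] keeps the first derivative among the first three directions, where it
    is mixed by [hblock p]. *)
Lemma polmx_symmap (p : 'M[F]_d) f :
  (forall i (j : 'I_d), (3 <= j)%N -> p (wid i) j = 0) ->
  polmx (symmap 3 p f) =1 tr (hblock p) p^T (polmx f).
Proof.
move=> p0 i; apply/matrixP => j k; rewrite mxE symmapE polar3_subst.
rewrite sum_wid => [|a a3]; last by rewrite p0 ?mul0r.
rewrite summxE; apply: eq_bigr => l _; rewrite !mxE; congr (_ * _).
rewrite exchange_big; apply: eq_bigr => b _ /=.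
rewrite trmxK !mxE mulr_suml; apply: eq_bigr => a _.
by rewrite !mxE mulrAC.
Qed.

(** If every third derivative involving one of the first three directions vanishes, then [f] is
    fixed by [u *m u^T], the coordinate projection onto F. *)
Lemma polmx_eq0 f : (forall i, polmx f i = 0) <-> f \in symF F d 3.
Proof.
split=> [f0|/memv_imgP[g _ ->] i]; last first.
  apply/matrixP => j k; rewrite !mxE symmapE polar3_subst big1 // => a _.
  rewrite mxE; case: eqP => [E|_]; last by rewrite mul0r.
  by have := wid_lt i; rewrite E; lia.
set u := incl_mx F d.
have E : f = symmap 3 (u *m u^T) f.
  apply/eqP; rewrite -subr_eq0; apply/eqP/val_inj => /=.
  have z (b : 'I_d) x y : (b < 3)%N -> polar3 (val f) b x y = 0.
    by move=> /widP[i ->]; have /matrixP/(_ x y) := f0 i; rewrite !mxE.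
  have uE (a b : 'I_d) : (u *m u^T) a b = ((a == b) && (3 <= a)%N)%:R.
    rewrite mxE; have [a3|a3] := leqP 3 a; last first.
      rewrite andbF big1 // => c _; rewrite !mxE.
      case: eqP => [E|_]; last by rewrite mul0r.
      by lia.
    have lt_a : (a - 3 < d - 3)%N by rewrite ltn_sub2r // (leq_ltn_trans a3).
    rewrite (bigD1 (Ordinal lt_a)) //= big1 => [|c]; last first.
      rewrite -val_eqE /= => ca; rewrite !mxE.
      by case: eqP => [E|_]; rewrite ?mul0r //; case/eqP: ca; lia.
    rewrite !mxE /= subnK // eqxx mul1r addr0 andbT eq_sym.
    by congr (nat_of_bool _)%:R; rewrite -val_eqE.
  apply: polar3_eq0; first by rewrite rpredB ?dhomog_is_dhomog.
  move=> i j k; rewrite addrC -scaleN1r polar3P mulN1r; apply/eqP.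
  rewrite addrC subr_eq0 symmapE polar3_subst; apply/eqP.
  transitivity (\sum_a (a == i)%:R * ((3 <= i)%:R * \sum_b (b == j)%:R *
    ((3 <= j)%:R * \sum_c (c == k)%:R * ((3 <= k)%:R * polar3 (val f) a b c)))).
    rewrite sum_delta sum_delta sum_delta.
    have [i3|i3] := ltnP i 3; first by rewrite z // mul0r.
    have [j3|j3] := ltnP j 3; first by rewrite polar3C12 z // !(mul0r, mulr0).
    have [k3|k3] := ltnP k 3; last by rewrite !mul1r.
    by rewrite polar3C23 polar3C12 z // !(mul0r, mulr0).
  apply: eq_bigr => a _; rewrite uE eq_sym -mulnb natrM -mulrA; congr (_ * (_ * _)).
  apply: eq_bigr => b _; rewrite uE eq_sym -mulnb natrM !mulr_sumr.
  by apply: eq_bigr => c _; rewrite uE [k == c]eq_sym -mulnb natrM; ring.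
by rewrite E symmapM comp_lfunE memv_img ?memvf.
Qed.

End CubicNets.

(** * The slice and the retraction onto it *)


Section PolynomialMatrices.
Variables (F : numFieldType) (U : vectType F).

Definition polymx m n (A : U -> 'M[F]_(m, n)) := forall i j, polyfun (fun u => A u i j).

Lemma polymxC m n (A : 'M[F]_(m, n)) : polymx (fun _ => A).
Proof. by move=> i j; apply: polyfunC. Qed.

Lemma polymxM m n p (A : U -> 'M[F]_(m, n)) (B : U -> 'M[F]_(n, p)) :
  polymx A -> polymx B -> polymx (fun u => A u *m B u).
Proof.
move=> pA pB i j; apply: polyfun_ext (fun u => esym (mxE _ _ i j)) _.
by apply: polyfun_sum => k; apply: polyfunM.
Qed.

Lemma polymx_tr m n (A : U -> 'M[F]_(m, n)) : polymx A -> polymx (fun u => (A u)^T).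
Proof. by move=> pA i j; apply: polyfun_ext (pA j i) => u; rewrite mxE. Qed.

Lemma polyfun_det n (A : U -> 'M[F]_n) : polymx A -> polyfun (fun u => \det (A u)).
Proof.
move=> pA; apply: polyfun_sum => s; apply: polyfunM (polyfunC _ _) _.
exact: polyfun_prod.
Qed.

Lemma polymx_adj n (A : U -> 'M[F]_n) : polymx A -> polymx (fun u => \adj (A u)).
Proof.
move=> pA i j; apply: polyfun_ext (fun u => esym (mxE _ _ i j)) _.
apply: polyfunM (polyfunC _ _) _; apply: polyfun_det => k l.
by apply: polyfun_ext (pA (lift j k) (lift i l)) => u; rewrite !mxE.
Qed.

Lemma polymx_lin_mx m n p q (f : U -> 'M[F]_(m, n) -> 'M[F]_(p, q)) :
  (forall V, polymx (fun u => f u V)) -> polymx (fun u => lin_mx (f u)).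
Proof.
move=> pf i j; case/mxvec_indexP: j => k l.
apply: polyfun_ext (pf (vec_mx (delta_mx 0 i)) k l) => u.
by rewrite mxE /= mxvecE.
Qed.

End PolynomialMatrices.

Section Slice.
Variables (F : numFieldType) (d : nat) (hd : (3 <= d)%N).
Local Notation nets := 'Hom(symv F 2 d, 'cV[F]_3).
Local Notation cubics := (symv F 3 d).
Local Notation qcubics := (quotv (symF F d 3)).
Local Notation wid := (wid hd).
Local Notation std := (std F hd).
Local Notation polmx := (polmx hd).

Definition slice_fun (x : qcubics) : nets := net_of (polmx (quotv_repr x)).

Lemma polmxP a (f g : cubics) i : polmx (a *: f + g) i = a *: polmx f i + polmx g i.
Proof. by apply/matrixP => j k; rewrite !mxE polar3P. Qed.

Lemma qmx_slice_fun (f : cubics) : qmx (slice_fun (quotv_pi _ f)) =1 polmx f.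
Proof.
move=> i; rewrite qmx_net_of; last exact: polmx_sym.
have /(polmx_eq0 hd)/(_ i) : quotv_repr (quotv_pi (symF F d 3) f) - f \in symF F d 3.
  exact: quotv_reprP.
rewrite addrC -scaleN1r polmxP scaleN1r => /eqP.
by rewrite addrC subr_eq0 => /eqP.
Qed.

Fact slice_linear : linear slice_fun.
Proof.
move=> a x y; rewrite -[x]quotv_reprK -[y]quotv_reprK -linearP; apply: qmx_inj => i.
by rewrite qmxP !qmx_slice_fun polmxP.
Qed.
HB.instance Definition _ :=
  GRing.isLinear.Build F qcubics nets *:%R slice_fun slice_linear.

Definition slice : 'Hom(qcubics, nets) := linfun slice_fun.

Lemma qmx_slice f : qmx (slice (quotv_pi _ f)) =1 polmx f.
Proof. by move=> i; rewrite [slice _]lfunE qmx_slice_fun. Qed.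

Lemma slice_inj : injective slice.
Proof.
move=> x y; rewrite -[x]quotv_reprK -[y]quotv_reprK => E.
apply/quotv_piP/(polmx_eq0 hd) => i.
rewrite addrC -scaleN1r polmxP scaleN1r addrC -!qmx_slice E.
by rewrite subrr.
Qed.

Lemma netker_slice x : netker (qmx (slice x)) std.
Proof.
rewrite -[x]quotv_reprK; apply: netker_ext (polmx_netker hd (quotv_repr x)) => i.
by rewrite qmx_slice.
Qed.

Lemma slice_onto Q : (forall i, (Q i)^T = Q i) -> netker Q std ->
  exists x, qmx (slice x) =1 Q.
Proof.
move=> Qs kQ; have [f fQ] := polmx_onto Qs kQ.
by exists (quotv_pi _ f) => i; rewrite qmx_slice.
Qed.

(* The columns are the rows of [V] followed by [e_4, ..., e_d]. *)
Definition frame (V : 'M[F]_(3, d)) : 'M[F]_d :=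
  \matrix_(a, b) if insub (val b) is Some i then V i a else (a == b)%:R.

Lemma std_frame V : std *m (frame V)^T = V.
Proof.
by rewrite mul_std; apply/matrixP => i a; rewrite !mxE valK.
Qed.

Lemma frame_std c : c != 0 -> \det (frame (c *: std)) != 0.
Proof.
move=> c0.
have -> : frame (c *: std) = diag_mx (\row_(j < d) if (j < 3)%N then c else 1).
  apply/matrixP => a b; rewrite !mxE.
  have [<-{b}|ab] := eqVneq a b; case: insubP => [i b3 ib|/negPf].
  - by rewrite !mxE -val_eqE /= ib (b3 : (a < 3)%N) eqxx mulr1.
  - by move=> /= ->.
  - by rewrite !mxE -val_eqE /= ib val_eqE eq_sym (negPf ab) mulr0.
  by [].
rewrite det_diag; apply/prodf_neq0 => i _; rewrite mxE.
by case: ifP; rewrite ?oner_neq0.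
Qed.

Definition netframe (n : nets) : 'M[F]_d := frame (kervec hd (qmx n)).

(** Where this is nonzero, the kernel is the line of [kervec] and its three rows complete e_4, ...,
    e_d to a basis. *)
Definition netdisc (n : nets) : F := kerdet hd (qmx n) * \det (netframe n).

Definition framed (n : nets) : nets := net_of (tr 1%:M (netframe n) (qmx n)).

(** The retraction onto the slice. It is polynomial everywhere, but [framed n] is known to lie in
    the image of [slice] only where [netdisc] does not vanish. *)
Definition section (n : nets) : qcubics := (slice^-1)%VF (framed n).

(** The frame sends e_1, e_2, e_3 to the kernel triple, so the standard triple lies in the kernel of
    the transformed net, which is therefore in the slice. *)
Lemma slice_section n : netdisc n != 0 ->
  qmx (slice (section n)) =1 tr 1%:M (netframe n) (qmx n).
Proof.
rewrite mulf_eq0 negb_or => /andP[D1 D2].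
have ts := tr_sym 1%:M (netframe n) (@qmx_sym _ _ n).
have uA : netframe n \in unitmx by rewrite unitmxE unitfE.
have [|x xE] := slice_onto ts.
  have := netker_tr 1%:M uA (kervec_netker (@qmx_sym _ _ n) D1).
  rewrite mul1mx -{1}[kervec _ _]std_frame -mulmxA -trmx_mul mulVmx //.
  by rewrite trmx1 mulmx1.
have -> : section n = x; last exact: xE.
apply: slice_inj; rewrite /section.
have <- : slice x = framed n by apply: qmx_inj => i; rewrite xE qmx_net_of.
rewrite lker0_lfunK //.
by apply/eqP/vspaceP => y; rewrite memv_ker memv0 -(inj_eq slice_inj) linear0.
Qed.

Lemma polymx_qmx i : polymx (fun n : nets => qmx n i).
Proof.
by move=> j k; apply: polyfun_linear => a u v; rewrite qmxP !mxE.
Qed.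

Lemma polymx_bordered V : polymx (fun n : nets => bordered hd (qmx n) V).
Proof.
have pr l l' j : polyfun (fun n : nets => (row l V *m qmx n l') 0 j).
  by apply: polymxM; [apply: polymxC | apply: polymx_qmx].
have pk i j : polyfun (fun n : nets => kermap (qmx n) V i j).
  apply: polyfun_ext
    (polyfunB (pr (i + 1) (i + 1 + 1) j) (pr (i + 1 + 1) (i + 1) j)) => n.
  by rewrite [RHS]mxE [RHS]mxE [X in _ = _ + X]mxE.
move=> i j.
pose g (n : nets) := kermap (qmx n) V i j
  + (V 0 (wid 0) - kermap (qmx n) V 0 (wid 0)) * delta_mx 0 (wid 0) i j.
apply: (@polyfun_ext _ _ g) => [n|].
  by rewrite [RHS]mxE [X in _ = _ + X]mxE.
apply: polyfunD (pk i j) _; apply: polyfunM (polyfunC _ _).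
exact: polyfunB (polyfunC _ _) (pk _ _).
Qed.

Lemma polymx_netframe : polymx netframe.
Proof.
move=> a b; case E : (insub (val b) : option 'I_3) => [i|]; last first.
  by apply: polyfun_ext (polyfunC _ (a == b)%:R) => n; rewrite mxE E.
have pv : polymx (fun n : nets =>
    mxvec (delta_mx 0 (wid 0)) *m \adj (lin_mx (bordered hd (qmx n)))).
  refine (polymxM (polymxC _ (mxvec (delta_mx 0 (wid 0)))) (polymx_adj _)).
  apply: polymx_lin_mx.
  exact: polymx_bordered.
by apply: polyfun_ext (pv 0 (mxvec_index i a)) => n; rewrite [RHS]mxE E [RHS]mxE.
Qed.

Lemma polyfun_netdisc : polyfun netdisc.
Proof.
apply: polyfunM; apply: polyfun_det; last exact: polymx_netframe.
exact/polymx_lin_mx/polymx_bordered.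
Qed.

Lemma polymap_section : polymap section.
Proof.
apply: polymap_linear_comp; apply: polymap_sum => x.
apply: polyfunM (polyfunC _ _) _; move: x.1.1 x.1.2 x.2 => i j k.
have p : polymx (fun n => (netframe n)^T *m qmx n i *m netframe n).
  apply: polymxM polymx_netframe; apply: polymxM (polymx_qmx _).
  exact/polymx_tr/polymx_netframe.
by apply: polyfun_ext (p j k) => n; rewrite tr1.
Qed.

End Slice.

(** * A net with one-dimensional kernel *)


Section Example.
Variables (F : numFieldType) (d : nat) (hd : (3 <= d)%N) (hodd : odd d).
Local Notation wid := (wid hd).
Local Notation std := (std F hd).
Implicit Types (Q : 'I_3 -> 'M[F]_d).

(** If [bordered Q] kills [W], then [W] has corner entry 0 and [kermap Q W] is concentrated in the
    corner. Pairing with [std], which is in the kernel, shows that it vanishes. *)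
Lemma kerdet_neq0 Q : (forall i, (Q i)^T = Q i) -> netker Q std ->
  (forall W, netker Q W -> W 0 (wid 0) = 0 -> W = 0) -> kerdet hd Q != 0.
Proof.
move=> Qs kQ H; apply/negP => /eqP/eqP/det0P[v v0 vL].
have [W vE] : exists W, v = mxvec W by exists (vec_mx v); rewrite vec_mxK.
move: v0 vL; rewrite vE mul_vec_lin mxvec_eq0 /= => W0 /eqP.
rewrite mxvec_eq0 => /eqP L0.
set c := kermap Q W 0 (wid 0).
have w0 : W 0 (wid 0) = 0.
  have /matrixP/(_ 0 (wid 0)) := L0; rewrite [LHS]mxE -/c [X in _ + X]mxE.
  by rewrite [delta_mx _ _ _ _]mxE !eqxx mulr1 addrC subrK mxE.
have KE : kermap Q W = c *: delta_mx 0 (wid 0).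
  move/eqP: L0; rewrite /bordered w0 sub0r scaleNr subr_eq0 => /eqP; exact.
have := kermap_skew W std Qs.
rewrite (iffRL (kermapP _ _) kQ) mul0mx mxtrace0 oppr0 KE trace_delta.
rewrite stdE eqxx mulr1 => c0.
case/eqP: W0; apply: H => //; apply/kermapP.
by rewrite KE c0 scale0r.
Qed.

(* The net of partial derivatives of
   [x y z + \sum_l (x a_l ^+ 2 / 2 + y a_l b_l + z b_l ^+ 2 / 2)], where
   [x, y, z] are the first three coordinates and the others are paired as
   [(a_l, b_l)], [a_l] having odd index; the pairing requires [d] to be odd. *)
Definition exb (i j k : nat) : bool :=
  (if (j < 3) && (k < 3) then [&& i != j, j != k & i != k]
  else [&& 3 <= j, 3 <= k &
    match i with
    | 0 => (j == k) && odd j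
    | 1 => odd j && (k == j.+1) || odd k && (j == k.+1)
    | _ => (j == k) && ~~ odd j
    end])%N.

Definition exnet (i : 'I_3) : 'M[F]_d := \matrix_(j, k) (exb i j k)%:R.

Lemma exb_sym i j k : exb i j k = exb i k j.
Proof.
rewrite /exb andbC; case: ifP => _.
  by rewrite [k == j]eq_sym; case: (i == j); case: (j == k); case: (i == k).
rewrite andbCA; congr [&& _, _ & _].
by case: i => [|[|i]]; rewrite 1?orbC // eq_sym; case: eqP => // ->.
Qed.

Lemma exnet_sym i : (exnet i)^T = exnet i.
Proof. by apply/matrixP => j k; rewrite !mxE exb_sym. Qed.

Lemma exb_low i j k : (k < 3)%N ->
  exb i j k = [&& (j < 3)%N, i != j, j != k & i != k].
Proof.
by move=> k3; rewrite /exb k3 andbT [(2 < k)%N]leqNgt k3 andbF; case: ifP.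
Qed.

Lemma exb_high i j k : (2 < k)%N -> exb i j k = (2 < j)%N &&
  match i with
  | 0%N => (j == k) && odd j
  | 1%N => odd j && (k == j.+1) || odd k && (j == k.+1)
  | _ => (j == k) && ~~ odd j
  end.
Proof. by move=> k3; rewrite /exb ltnNge [in X in _ && X]ltnNge k3 andbF. Qed.

Lemma exb_swap i j k : (i < 3)%N -> (j < 3)%N -> exb j i k = exb i j k.
Proof.
move=> i3 j3; rewrite /exb i3 j3 /= [(2 < i)%N]leqNgt i3 [(2 < j)%N]leqNgt j3.
case: ifP => // _; rewrite [j == i]eq_sym; case: (i == j) => //=.
by rewrite andbC.
Qed.

Lemma exnet_std : netker exnet std.
Proof.
move=> i j; rewrite !row_std; apply/rowP => k; rewrite !mxE.
by rewrite exb_swap ?wid_lt //; apply: wid_lt.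
Qed.

Lemma exnet_one W (i j : 'I_3) (a k0 : 'I_d) :
  (forall k : 'I_d, exb j k a = (k == k0 :> nat)) ->
  (row i W *m exnet j) 0 a = W i k0.
Proof.
move=> E; rewrite mxE (bigD1 k0) //= big1 => [|k kk]; rewrite !mxE E.
  by rewrite eqxx mulr1 addr0.
by move: kk; rewrite -val_eqE /= => /negPf ->; rewrite mulr0.
Qed.

Lemma exnet_none W (i j : 'I_3) (a : 'I_d) : (forall k : 'I_d, exb j k a = false) ->
  (row i W *m exnet j) 0 a = 0.
Proof. by move=> E; rewrite mxE big1 // => k _; rewrite !mxE E mulr0. Qed.

Lemma exnet_netker W : netker exnet W -> W 0 (wid 0) = 0 -> W = 0.
Proof.
move=> kW W00.
have e i j a : (row i W *m exnet j) 0 a = (row j W *m exnet i) 0 a by rewrite kW.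
have one (i j l : 'I_3) : i != j -> j != l -> i != l ->
    forall k : 'I_d, exb j k (wid i) = (k == wid l :> nat).
  rewrite -!val_eqE /= => ij jl il k; rewrite exb_low ?wid_lt //=.
  have := ltn_ord i; have := ltn_ord j; have := ltn_ord l; lia.
(* The first three coordinates see only the term [x y z]: off-diagonal entries vanish, and by [dg]
   the diagonal ones are equal, hence 0 by the corner condition. *)
have off (i j l : 'I_3) : i != j -> j != l -> i != l -> W i (wid l) = 0.
  move=> ij jl il; have := e i j (wid i); rewrite (exnet_one _ _ (one _ _ _ ij jl il)).
  by move=> ->; apply: exnet_none => k; rewrite exb_low ?wid_lt //= eqxx !andbF.
have dg (i j l : 'I_3) : i != j -> j != l -> i != l -> W i (wid i) = W j (wid j).
  move=> ij jl il; have := e i j (wid l).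
  rewrite (exnet_one _ _ (one l j i _ _ _)) 1?(exnet_one _ _ (one l i j _ _ _)) //;
    by rewrite eq_sym.
have top i (k : 'I_d) : (k < 3)%N -> W i k = 0.
  case/(widP hd) => l ->; have [<-{l}|il] := eqVneq i l.
    have [<-//|i0] := eqVneq 0 i.
    have [l [l0 li]] : exists l : 'I_3, 0 != l /\ i != l.
      by case: i i0 => [[|[|[|//]]] ?] // _; [exists 2%:R | exists 1].
    by rewrite -(dg 0 i l) // eq_sym.
  have [j [ij jl]] : exists j : 'I_3, i != j /\ j != l.
    case: i l il => [[|[|[|//]]] ?] [[|[|[|//]]] ?] // _;
      by [exists 0 | exists 1 | exists 2%:R].
  exact: off ij jl il.
(* At coordinate [a] one side of the kernel equation is a single entry of [W] and the other side is
   empty. *)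
have cst (i j : 'I_3) (a b : 'I_d) :
    (forall k : 'I_d, exb j k a = (k == b :> nat)) ->
    (forall k : 'I_d, exb i k a = false) -> W i b = 0.
  by move=> Ej Ei; have := e i j a; rewrite (exnet_one _ _ Ej) exnet_none.
have pair (a b : 'I_d) : (3 <= a)%N -> odd a -> b = a.+1 :> nat ->
    forall i, W i a = 0 /\ W i b = 0.
  move=> a3 oa ba.
  have E0a (k : 'I_d) : exb (0%R : 'I_3) k a = (k == a :> nat).
    by rewrite exb_high //=; lia.
  have N0b (k : 'I_d) : exb (0%R : 'I_3) k b = false by rewrite exb_high /=; lia.
  have E1a (k : 'I_d) : exb (1%R : 'I_3) k a = (k == b :> nat).
    by rewrite exb_high //=; lia.
  have E1b (k : 'I_d) : exb (1%R : 'I_3) k b = (k == a :> nat).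
    by rewrite exb_high /=; lia.
  have N2a (k : 'I_d) : exb (2%R : 'I_3) k a = false by rewrite exb_high //=; lia.
  have E2b (k : 'I_d) : exb (2%R : 'I_3) k b = (k == b :> nat).
    by rewrite exb_high /=; lia.
  have W2a : W 2 a = 0 by apply: cst E0a N2a.
  have W2b : W 2 b = 0 by apply: cst E1a N2a.
  have W0a : W 0 a = 0 by apply: cst E1b N0b.
  have W0b : W 0 b = 0 by apply: cst E2b N0b.
  (* The two entries in row 1 are not isolated by a single equation; each is equated with an entry
     already known to vanish. *)
  have W1a : W 1 a = 0.
    by have := e 0 1 a; rewrite (exnet_one _ _ E1a) (exnet_one _ _ E0a) W0b.
  have W1b : W 1 b = 0.
    by have := e 1 2 b; rewrite (exnet_one _ _ E2b) (exnet_one _ _ E1b) W2a.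
  move=> i; have [->|->|->] : [\/ i = 0, i = 1 | i = 2] => //.
  by case: i => [[|[|[|//]]] ?];
    [apply: Or31 | apply: Or32 | apply: Or33]; apply: val_inj.
apply/matrixP => i k; rewrite mxE; have [/top//|k3] := ltnP k 3.
have [ok|ek] := boolP (odd k).
  (* Here the oddness of [d] is used: an odd index below [d] has its partner [k.+1] below [d]
     too. *)
  have lt_k : (k.+1 < d)%N by have := ltn_ord k; lia.
  by have [] := pair k (Ordinal lt_k) k3 ok erefl i.
have lt_k : (k.-1 < d)%N by have := ltn_ord k; lia.
by have [] := pair (Ordinal lt_k) k _ _ _ i => //=; lia.
Qed.

Lemma netdisc_neq0 : exists x, netdisc hd (slice F hd x) != 0.
Proof.
have [x xE] := slice_onto exnet_sym exnet_std; exists x.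
have D0 : kerdet hd (qmx (slice F hd x)) != 0.
  have -> : qmx (slice F hd x) = exnet by apply/funext.
  exact: kerdet_neq0 exnet_sym exnet_std exnet_netker.
rewrite mulf_neq0 // /netframe.
have /= E := netker_kervec (@qmx_sym _ _ (slice F hd x)) D0 (netker_slice _ x).
(* The standard triple lies in the kernel and has corner entry 1, which fixes the factor. *)
have -> : kervec hd (qmx (slice F hd x)) = kerdet hd (qmx (slice F hd x)) *: std.
  rewrite [in RHS]E stdE eqxx scalerA div1r divff ?scale1r //.
exact: frame_std.
Qed.

End Example.

(** * Orbits of nets and orbits of cubics *)


Section Orbits.
Variables (F : numClosedFieldType) (d : nat) (hd : (3 <= d)%N).
Local Notation nets := 'Hom(symv F 2 d, 'cV[F]_3).
Local Notation qcubics := (quotv (symF F d 3)).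
Local Notation wid := (wid hd).
Local Notation std := (std F hd).
Local Notation slice := (slice F hd).

(** Division by an [n]-th root of the determinant, which exists over an algebraically closed
    field. *)
Lemma SL_multiple n (A : 'M[F]_n) : (0 < n)%N -> A \in unitmx ->
  exists (a : F) (B : SL F n), a != 0 /\ A = a *: val (val B).
Proof.
move=> n0 uA; pose a := n.-root (\det A).
have aE : a ^+ n = \det A by rewrite rootCK.
have a0 : a != 0.
  apply: contraTneq uA => a0.
  by rewrite unitmxE unitfE -aE a0 expr0n gtn_eqF //= eqxx.
have dB : \det (a^-1 *: A) = 1.
  by rewrite detZ -aE exprVn mulVf // expf_neq0.
have uB : a^-1 *: A \in unitmx by rewrite unitmxE dB unitr1.
have sB : SL_pred (MkGL uB) by apply/eqP.
by exists a, (MkSL sB); split=> //=; rewrite scalerA divff // scale1r.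
Qed.

(** The scalars split off from [h] and [B] are collected in the homothety, so the group acts with
    the same orbits as GL_3 and GL_d together. *)
Lemma netrep_orbit (h : 'M[F]_3) (B : 'M[F]_d) :
  h \in unitmx -> B \in unitmx ->
  exists x, forall n, qmx (netrep F d x n) =1 tr h B (qmx n).
Proof.
move=> uh uB.
have [a [h1 [a0 ->]]] := SL_multiple (isT : 0 < 3)%N uh.
have [b [B1 [b0 ->]]] := SL_multiple (ltnW (ltnW hd)) uB.
have c0 : a * b ^+ 2 != 0 by rewrite mulf_neq0 ?expf_neq0.
exists ((B1^-1)%g, h1, MkGm c0) => n i.
rewrite qmx_netrep invgK trZ -[val (val B1)]scale1r trZ.
by rewrite expr1n mulr1 scale1r.
Qed.

Lemma netrep_tr x : exists h B, [/\ h \in unitmx, B \in unitmx &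
  forall n, qmx (netrep F d x n) =1 tr h B (qmx n)].
Proof.
case: x => [[g h] c]; exists (val c *: val (val h)), (val (val (g^-1)%g)).
split; [|exact: valP|exact: qmx_netrep].
by rewrite unitmxZ ?(valP (val h)) // unitfE; apply: (valP c).
Qed.

Lemma parabquotrepE (p : parab F d) (f : symv F 3 d) :
  parabquotrep F d p (quotv_pi _ f) = quotv_pi _ (symmap 3 (val (val p)) f).
Proof.
rewrite [LHS]lfunE => [|stab]; first exact: parab_stab.
exact: (quotrep_funE stab).
Qed.

Lemma qmx_slice_parab (p : parab F d) x :
  qmx (slice (parabquotrep F d p x))
  =1 tr (hblock hd (val (val p))) (val (val p))^T (qmx (slice x)).
Proof.
move=> i; rewrite -[x]quotv_reprK parabquotrepE qmx_slice polmx_symmap; last first.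
  by move=> l j j3; apply: (elimT (parab_predP _) (valP p)); rewrite ?wid_lt.
by apply: tr_ext => l; rewrite qmx_slice.
Qed.

Lemma std_parab (p : parab F d) :
  std *m val (val p) = hblock hd (val (val p)) *m std.
Proof.
rewrite mul_std; apply/matrixP => i j; rewrite !mxE.
have [j3|j3] := ltnP j 3.
  have [l ->] := widP hd j3; rewrite (bigD1 l) //= big1 => [|k /negPf kl].
    by rewrite !mxE eqxx mulr1 addr0.
  by rewrite !mxE (inj_eq (@wid_inj d hd)) kl mulr0.
rewrite (elimT (parab_predP _) (valP p)) ?wid_lt // big1 // => k _.
rewrite !mxE; case: eqP => [E|]; last by rewrite mulr0.
by rewrite -E leqNgt wid_lt in j3.
Qed.

(** The relation [std_parab] for [p] and for its inverse shows that their blocks are mutually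
    inverse. *)
Lemma hblock_unit (p : parab F d) : hblock hd (val (val p)) \in unitmx.
Proof.
have E : std *m val (val p) *m val (val (p^-1)%g) = std.
  by rewrite -mulmxA [val (val p^-1)%g]/= mulmxV ?mulmx1 // (valP (val p)).
have S1 : std *m std^T = 1%:M.
  apply/matrixP => i j; rewrite mxE (bigD1 (wid i)) //= big1 => [|k /negPf ki].
    by rewrite !mxE eqxx mul1r addr0 (inj_eq (@wid_inj d hd)) eq_sym.
  by rewrite !mxE eq_sym ki mul0r.
move: E; rewrite std_parab -mulmxA std_parab mulmxA => /(congr1 (mulmx^~ std^T)).
by rewrite /= -mulmxA S1 mulmx1 => /mulmx1_unit[].
Qed.

(** Both [std] and its transport from the net of [x] lie in the kernel line of the net of [y], hence
    are proportional. So [B^T] preserves the row span of [std], which puts its multiples in P. *)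
Lemma slice_same_orbit (h : 'M[F]_3) (B : 'M[F]_d) x y :
  h \in unitmx -> B \in unitmx -> netker_line (qmx (slice y)) ->
  qmx (slice y) =1 tr h B (qmx (slice x)) ->
  exists p, y = parabquotrep F d p x.
Proof.
move=> uh uB [V HV] yE.
have [a stdV] := HV _ (netker_slice hd y).
have kV1 : netker (qmx (slice y)) (h *m std *m (invmx B)^T).
  apply: netker_ext (netker_tr h uB (netker_slice hd x)) => i; exact/esym.
have [b V1E] := HV _ kV1.
have hstd : h *m std = b *: (V *m B^T).
  rewrite scalemxAl -V1E -[_ *m _ *m B^T]mulmxA -trmx_mul mulmxV //.
  by rewrite trmx1 mulmx1.
have std0 : std != 0.
  apply/eqP => /matrixP/(_ 0 (wid 0)); rewrite !mxE eqxx => /eqP.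
  by rewrite oner_eq0.
have a0 : a != 0 by apply: contraNneq std0 => a0; rewrite stdV a0 scale0r.
have b0 : b != 0.
  apply: contraNneq std0 => b0; move: hstd; rewrite b0 scale0r.
  by move/(congr1 (mulmx (invmx h))); rewrite mulKmx // mulmx0 => ->.
(* The rows of the sought element of P must be adapted to the kernel line; the
   remaining scalar [c] is absorbed by a homothety of ratio [l]. *)
pose c := b / a.
have c0 : c != 0 by rewrite mulf_neq0 ?invr_eq0.
pose l := 3.-root c.
have l3 : l ^+ 3 = c by rewrite rootCK.
have l0 : l != 0 by apply: contraNneq c0 => l0; rewrite -l3 l0 expr0n.
have BE : std *m (l *: B^T) = (l / c) *: (h *m std).
  rewrite hstd -scalemxAr scalerA {1}stdV -scalemxAl scalerA.
  by congr (_ *: _); rewrite /c; field; rewrite a0 b0.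
have up : l *: B^T \in unitmx by rewrite unitmxZ ?unitfE ?unitmx_tr.
have pE i j : (l *: B^T) (wid i) j = (l / c) * (h *m std) i j.
  by have /matrixP/(_ i j) := BE; rewrite mul_std [LHS]mxE [RHS]mxE.
have pp : parab_pred (MkGL up).
  apply/parab_predP => i' j /(widP hd)[i ->] j3.
  rewrite /= pE mxE big1 ?mulr0 // => k _.
  rewrite !mxE; case: eqP => [E|]; last by rewrite mulr0.
  by rewrite -E leqNgt wid_lt in j3.
exists (MkParab pp); apply: (@slice_inj _ _ hd); apply: qmx_inj => i.
rewrite qmx_slice_parab yE /= [(l *: B^T)^T]linearZ /= trmxK.
have -> : hblock hd (l *: B^T) = (l / c) *: h.
  apply/matrixP => j k; rewrite mxE pE [RHS]mxE; congr (_ * _).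
  rewrite mxE (bigD1 k) //= big1 => [|k' /negPf kk].
    by rewrite stdE eqxx mulr1 addr0.
  by rewrite stdE (inj_eq (@wid_inj d hd)) kk mulr0.
rewrite trZ; have -> : l / c * l ^+ 2 = 1; last by rewrite scale1r.
by rewrite mulrAC -exprS l3 divff.
Qed.

Lemma netdisc_line (n : nets) : netdisc hd n != 0 -> netker_line (qmx n).
Proof.
rewrite mulf_eq0 negb_or => /andP[D1 _]; exists (kervec hd (qmx n)) => W kW.
eexists; exact: netker_kervec (@qmx_sym _ _ n) D1 kW.
Qed.

Lemma netdisc_frame_unit (n : nets) : netdisc hd n != 0 -> netframe hd n \in unitmx.
Proof. by rewrite mulf_eq0 negb_or unitmxE unitfE => /andP[]. Qed.

Lemma unitmx_invMM n (A B C : 'M[F]_n) : A \in unitmx -> B \in unitmx ->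
  C \in unitmx -> invmx A *m B *m C \in unitmx.
Proof. by move=> uA uB uC; rewrite !unitmx_mul unitmx_inv uA uB uC. Qed.

(** Passing from the retraction of a net to that of its translate: undo the frame [A], apply [B],
    then use the new frame [A']. *)
Lemma tr_reframe h (A B A' : 'M[F]_d) (Q : 'I_3 -> 'M[F]_d) : A \in unitmx ->
  tr h (invmx A *m B *m A') (tr 1%:M A Q) =1 tr 1%:M A' (tr h B Q).
Proof.
by move=> uA i; rewrite !tr_tr mul1mx mulmx1 -!mulmxA mulKVmx.
Qed.

Lemma netfield_parabfield (hodd : odd d) :
  exists phi : {rmorphism netfield F d -> parabfield F d},
    bijective phi /\
    (forall c, phi (inv_scalar (netrep F d) c) = inv_scalar (parabquotrep F d) c).
Proof.
have [x0 D0] := netdisc_neq0 F hd hodd.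
have pD := polyfun_netdisc F hd.
have pslice := polymap_lfun slice.
have gD := generically_polyfun pD (ex_intro _ (slice x0) D0).
have u1 := unitmx1 F 3.
apply: (invfield_iso (i := slice) (s := section hd)) => //.
- exact: polymap_section.
(* Retracting a net moves it by its own frame, an element of GL_d. *)
- have [D DN0 DE] := gD; exists D => // n /DE Dn.
  have [g gE] := netrep_orbit u1 (netdisc_frame_unit Dn); exists g.
  by apply: qmx_inj => i; rewrite gE slice_section.
(* On the slice, the retraction joins two points of the slice by a frame, and [slice_same_orbit]
   replaces it by an element of P. *)
- have [||D DN0 DE] := @generically_polyfun _ _ (fun x => netdisc hd (slice x)).
  + exact: polyfun_comp.
  + by exists x0.
  exists D => // x /DE Dn.
  apply: (slice_same_orbit u1 (netdisc_frame_unit Dn) _ (slice_section Dn)).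
  have -> : qmx (slice (section hd (slice x)))
      = tr 1%:M (netframe hd (slice x)) (qmx (slice x)).
    by apply/funext => i; apply: slice_section.
  exact: netker_line_tr u1 (netdisc_frame_unit Dn) (netdisc_line Dn).
(* The inclusion is equivariant at every point, so the open set is the whole space. *)
- move=> p; exists 1; first exact: oner_neq0.
  move=> x _; have up : (val (val p))^T \in unitmx by rewrite unitmx_tr (valP (val p)).
  have [g gE] := netrep_orbit (hblock_unit p) up; exists g.
  by apply: qmx_inj => i; rewrite qmx_slice_parab gE.
move=> g.
have [||D' DN0' DE'] := @generically_polyfun _ _ (fun n => netdisc hd (netrep F d g n)).
- exact: polyfun_comp (polymap_lfun _) pD.
(* The translate by [g] of this net is the good net [slice x0]. *)
- exists (netrep F d g^-1%g (slice x0)).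
  by rewrite -comp_lfunE -linrepM mulgV linrep1 id_lfunE.
have [D DN0 DE] := gD; exists (D * D'); first exact: mulf_neq0.
move=> n; rewrite evalpolyM mulf_eq0 negb_or => /andP[/DE Dn /DE' Dgn].
have [h [B [uh uB gE]]] := netrep_tr g.
set A := netframe hd n; set A' := netframe hd (netrep F d g n).
have uA : A \in unitmx := netdisc_frame_unit Dn.
have uA' : A' \in unitmx := netdisc_frame_unit Dgn.
apply: (@slice_same_orbit h (invmx A *m B *m A')) => //.
- exact: (unitmx_invMM uA uB uA').
- have -> : qmx (slice (section hd (netrep F d g n)))
      = tr 1%:M A' (qmx (netrep F d g n)).
    by apply/funext => i; apply: slice_section.
  exact: netker_line_tr u1 uA' (netdisc_line Dgn).
move=> i; rewrite slice_section // (tr_ext _ _ (gE n)) (tr_ext _ _ (slice_section Dn)).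
exact: (esym (tr_reframe h B A' (qmx n) uA i)).
Qed.

End Orbits.

Theorem proposition2p2p1p5 (R : realType) (d : nat)
    (hd : (5 <= d)%N) (hodd : odd d) :
  exists phi : {rmorphism netfield R[i] d -> parabfield R[i] d},
    bijective phi /\
    (forall c : R[i],
       phi (inv_scalar (netrep R[i] d) c) = inv_scalar (parabquotrep R[i] d) c).
Proof. exact: netfield_parabfield (ltnW (ltnW hd)) hodd. Qed.
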